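(* Let $\alpha$ be the endomorphism of $\mathrm{A}(\mathbb{D})$ induced by a non-constant finite Blaschke product $b$, i.e. $\alpha(f)=f\circ b$, and let $A,T\in\mathcal{B}(\mathcal{H})$ be contractions on a Hilbert space $\mathcal{H}$ satisfying $AT=T\alpha(A)$. Then there exist unitary operators $U$ and $W$ on a Hilbert space $\mathcal{K}\supset\mathcal{H}$ which simultaneously dilate $A$ and $T$, in the sense that $$P_{\mathcal{H}}W^mU^n|_{\mathcal{H}}=T^mA^n\quad\text{for all } m,n\ge0,$$ and such that $UW=W\alpha(U)$.
   Context: $\mathrm{A}(\mathbb{D})$ is the disk algebra. For a contraction $A$ on a Hilbert space, $\alpha(A)$ means $b(A)$, where $b=\alpha(z)\in\mathrm{A}(\mathbb{D})$ and $f\mapsto f(A)$ is the disk algebra functional calculus (the contractive extension of $p\mapsto p(A)$ from polynomials, by von Neumann's inequality); likewise $\alpha(U)=b(U)$. $P_{\mathcal{H}}$ is the orthogonal projection of $\mathcal{K}$ onto $\mathcal{H}$. *)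

(* Defs.v *)
From HB Require Import structures.
From mathcomp Require Import all_boot all_order all_algebra.
From mathcomp Require Import complex sesquilinear.
From mathcomp Require Import all_classical all_reals all_analysis.

Set Implicit Arguments.
Unset Strict Implicit.
Unset Printing Implicit Defensive.

Import Order.TTheory GRing.Theory Num.Theory.
Import numFieldNormedType.Exports.

Local Open Scope classical_set_scope.
Local Open Scope ring_scope.

(* Complex Hilbert spaces.  The inner product is linear in its first argument
   and conjugate-linear in the second; H may be trivial or non-separable. *)
HB.mixin Record NormedModule_isHilbert (R : realType) H
    & NormedModule R[i] H := {
  hdot : {dot H for (@Num.conj R[i])} ;
  hdot_norm : forall x : H, hdot x x = `|x| ^+ 2
}.

#[short(type="hilbertType")]
HB.structure Definition Hilbert (R : realType) :=
  { H of CompleteNormedModule R[i] H & NormedModule_isHilbert R H }.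

Local Notation "''[' x , y ]" := (hdot x y) : ring_scope.

Section Operators.
Context {R : realType}.
Implicit Types H K : hilbertType R.

(* Every contraction is bounded, and so is every unitary operator, which is
   why boundedness is not a separate field of either definition. *)
Definition contractive H (A : {linear H -> H}) := forall x, `|A x| <= `|x|.

Definition is_adjoint H (A B : {linear H -> H}) :=
  forall x y, '[A x, y] = '[x, B y].

Definition unitary H (U : {linear H -> H}) :=
  exists2 V : {linear H -> H}, is_adjoint U V & cancel U V /\ cancel V U.

(* The range of an isometry J : H -> K is the copy of H inside K. *)
Definition isometric_embedding H K (J : {linear H -> K}) :=
  forall x y, '[J x, J y] = '[x, y].

(* The orthogonal projection onto M; it is meant for closed subspaces, where
   the point below exists and is unique. *)
Definition orth_proj K (M : set K) (x : K) : K :=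
  get [set y | M y /\ forall z, M z -> '[x - y, z] = 0].

Definition poly_op H (A : {linear H -> H}) (p : {poly R[i]}) (x : H) : H :=
  \sum_(i < size p) p`_i *: iter i A x.

End Operators.

Section DiskAlgebra.
Context {R : realType}.

Definition open_disk : set R[i] := [set z | `|z| < 1].
Definition closed_disk : set R[i] := [set z | `|z| <= 1].

(* Elements are represented by total functions, of which only the values on
   the closed disk matter.  R[i]^o is R[i] with its topology. *)
Record disk_algebra := DiskAlgebra {
  disk_fun :> R[i] -> R[i] ;
  disk_fun_continuous :
    {within (closed_disk : set R[i]^o), continuous (disk_fun : R[i]^o -> R[i]^o)} ;
  disk_fun_holomorphic : forall z, open_disk z ->
    derivable (disk_fun : R[i]^o -> R[i]^o) z 1
}.

Lemma id_continuous_disk :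
  {within (closed_disk : set R[i]^o), continuous (id : R[i]^o -> R[i]^o)}.
Proof. by apply: continuous_subspaceT => x; exact: cvg_id. Qed.

Lemma id_holomorphic_disk (z : R[i]) : open_disk z ->
  derivable (id : R[i]^o -> R[i]^o) z 1.
Proof. by move=> _; exact: derivable_id. Qed.

Definition disk_z : disk_algebra :=
  DiskAlgebra id_continuous_disk id_holomorphic_disk.

Definition finite_blaschke (b : R[i] -> R[i]) :=
  exists (c : R[i]) (s : seq R[i]),
    [/\ `|c| = 1, forall a, a \in s -> open_disk a &
        forall z, closed_disk z ->
          b z = c * \prod_(a <- s) ((z - a) / (1 - Num.conj a * z))].

Definition nonconstant_on_disk (b : R[i] -> R[i]) :=
  exists z w, [/\ closed_disk z, closed_disk w & b z <> b w].

(* alpha (f) = f \o b, as functions on the closed disk *)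
Definition induced_by (b : R[i] -> R[i]) (alpha : disk_algebra -> disk_algebra) :=
  forall (f : disk_algebra) z, closed_disk z -> alpha f z = f (b z).

(* f(A) is obtained by extending p |-> p(A) by continuity: it is the limit of
   p(A) in operator norm as the polynomial p tends to f uniformly on the closed
   disk.  For a contraction A the limit exists by von Neumann's inequality, and
   it is unique because polynomials are dense in the disk algebra. *)
Definition disk_calculus (H : hilbertType R) (A : {linear H -> H})
    (f : disk_algebra) : H -> H :=
  get [set B : H -> H | forall e : R[i], 0 < e -> exists2 d : R[i], 0 < d &
    forall p : {poly R[i]}, (forall z, closed_disk z -> `|p.[z] - f z| <= d) ->
      forall x, `|poly_op A p x - B x| <= e * `|x| ].

(* alpha(A), that is b(A) where b = alpha(z) *)
Definition endo_op (alpha : disk_algebra -> disk_algebra) (H : hilbertType R)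
    (A : {linear H -> H}) : H -> H := disk_calculus A (alpha disk_z).

End DiskAlgebra.

Arguments disk_algebra R : clear implicits.

(* Main.v *)
Require Import Defs.
From HB Require Import structures.
From mathcomp Require Import all_boot all_order all_algebra.
From mathcomp Require Import complex sesquilinear.
From mathcomp Require Import all_classical all_reals all_analysis.
From mathcomp Require cyclic separable cyclotomic.
From mathcomp Require Import ring zify.

Set Implicit Arguments.
Unset Strict Implicit.
Unset Printing Implicit Defensive.

Import Order.TTheory GRing.Theory Num.Theory.
Import numFieldNormedType.Exports.

Local Open Scope classical_set_scope.
Local Open Scope ring_scope.

(** The proof dilates A first and T afterwards, keeping track of the relation
   A T = T b(A).

   Functional calculus. Every contraction A has an isometric coextension V on
   H + L + L + ..., where L completes H for the form <x, y> - <A x, A y>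
   ([isometric_coextension]). Averaging over roots of unity bounds p(V) by the
   maximum of p on the disk, and compression carries the bound over to p(A)
   ([von_neumann]). This gives meaning to b(A), for every contraction A and every
   finite Blaschke product b, and makes b(A) multiplicative in the factors of b.
   Factor by factor one finds that b maps isometries to isometries and unitaries
   to unitaries, and that an isometry V is unitary as soon as b(V) is, b being
   non-constant ([blaschke_isometric], [blaschke_bijective],
   [bijective_of_blaschke]).

   Dilating A. The operator T lifts to a contraction S with V S = S b(V)
   ([intertwining_lift]): this is a commutant lifting theorem, and S is obtained
   from one contractive extension on the defect space of T p, p being the
   compression to H. On the direct limit along the isometry b(V) the operator V
   becomes a unitary U, and S extends to satisfy U S = S b(U)
   ([unitary_extension]).

   Dilating T. Taking adjoints, S^* U = b(U) S^*. The adjoint S^* is coextended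
   to an isometry J with b(U) J = J U ([coisometric_extension]). Where J shifts
   one copy of the defect space into the next one, the unitary on the target has
   to be a b-root of the unitary on the source. Such roots exist on larger spaces
   ([blaschke_root]): b maps the circle to itself as a d-fold cover, and the root
   of a unitary X on N acts on N^d, as the evolution of the Blaschke factors
   connected in series with X as feedback. Finally, the direct limit along J
   ([unitary_direct_limit]) makes J invertible. Its inverse is W, and the relation
   becomes U W = W b(U).

   For x and y in H one then has <W^m U^n x, y> = <U^n x, J^m y>
   = <S^m U^n x, y> = <T^m A^n x, y>, because J^m coextends the adjoint of S^m,
   S extends and lifts T, and p V = A p. This identifies the projection of
   W^m U^n x to H ([orth_proj_range]). *)

(** * Limits with an explicit rate *)

Section Sequences.
Context {R : realType}.
Local Notation C := R[i].

Lemma eqle (x y : C) : x = y -> x <= y.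
Proof. by move->. Qed.

Definition rate (n : nat) : C := n.+1%:R^-1.

Lemma rate_gt0 n : 0 < rate n.
Proof. by rewrite invr_gt0 ltr0Sn. Qed.

Lemma rate_ge0 n : 0 <= rate n.
Proof. exact/ltW/rate_gt0. Qed.

Lemma posC_real (e : C) : 0 < e -> exists2 r : R, 0 < r & e = r%:C%C.
Proof.
case: e => a b; rewrite ltcE /= => /andP[/eqP -> a0].
by exists a.
Qed.

Lemma rate_le_nat (e : C) : 0 < e -> exists N, forall n, (N <= n)%N -> rate n <= e.
Proof.
move=> /posC_real [r r0 ->]; have [N hN] := ltr_add_invr r0.
exists N => n Nn; rewrite /rate -(rmorph_nat (real_complex R)) -fmorphV lecR.
move: hN; rewrite add0r => hN; apply: ltW; apply: le_lt_trans hN.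
by rewrite lef_pV2 ?posrE ?ltr0Sn // ler_nat ltnS.
Qed.

Lemma mul_divD1_le (M e : C) : 0 <= M -> 0 < e -> M * (e / (M + 1)) <= e.
Proof.
move=> M0 e0; rewrite mulrCA ger_pMr // ler_pdivrMr ?mul1r ?lerDl //.
by rewrite ltr_wpDl.
Qed.

Lemma le_rate (x y M : C) : 0 <= M -> (forall n, x <= y + M * rate n) -> x <= y.
Proof.
move=> M0 h; apply/ler_addgt0Pr => e e0.
have d0 : 0 < e / (M + 1) by rewrite divr_gt0 // ltr_wpDl.
have [N /(_ N (leqnn _)) hN] := rate_le_nat d0.
apply: le_trans (h N) _; rewrite lerD2l.
exact: le_trans (ler_wpM2l M0 hN) (mul_divD1_le M0 e0).
Qed.

Lemma fast_cauchy (V : normedModType C) (u : nat -> V) (M : C) : 0 <= M ->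
  (forall m n, `|u m - u n| <= M * (rate m + rate n)) ->
  forall e, 0 < e -> exists N, forall m n, (N <= m)%N -> (N <= n)%N ->
    `|u m - u n| <= e.
Proof.
move=> M0 uC e e0.
have d0 : 0 < e / (M + 1) / 2 by rewrite !divr_gt0 // ltr_wpDl.
have [N hN] := rate_le_nat d0; exists N => m n Nm Nn.
apply: le_trans (uC _ _) _; apply: le_trans (mul_divD1_le M0 e0).
by rewrite ler_wpM2l // [leRHS]splitr lerD // hN.
Qed.

(** In a Cauchy estimate with rate 1/(n+1) one of the two indices can be sent to
   infinity without losing the constant. The completion, the factorisation of
   operators and the functional calculus take their limits at this rate. *)
Lemma fast_limit (V : normedModType C) (u : nat -> V) (M : C) (l : V) : 0 <= M ->
  (forall m n, `|u m - u n| <= M * (rate m + rate n)) ->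
  (forall e, 0 < e -> exists N, forall n, (N <= n)%N -> `|u n - l| <= e) ->
  forall n, `|u n - l| <= M * rate n.
Proof.
move=> M0 uC ul n; apply/ler_addgt0Pr => e e0.
have e20 : 0 < e / 2 by rewrite divr_gt0.
have d0 : 0 < e / 2 / (M + 1) by rewrite divr_gt0 // ltr_wpDl.
have [N1 hN1] := ul _ e20.
have [N2 hN2] := rate_le_nat d0.
set m := maxn N1 N2.
rewrite -(subrKA (u m)); apply: le_trans (ler_normD _ _) _.
rewrite [e]splitr addrA lerD ?hN1 ?leq_maxl //.
apply: le_trans (uC _ _) _; rewrite mulrDr lerD2l.
exact: le_trans (ler_wpM2l M0 (hN2 m (leq_maxr _ _))) (mul_divD1_le M0 e20).
Qed.

Lemma complete_limit (K : numFieldType) (V : completeNormedModType K)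
    (u : nat -> V) :
  (forall e, 0 < e -> exists N, forall m n, (N <= m)%N -> (N <= n)%N ->
     `|u m - u n| <= e) ->
  exists l, forall e, 0 < e -> exists N, forall n, (N <= n)%N -> `|u n - l| <= e.
Proof.
move=> uC; have : cauchy (u @ \oo).
  apply/cauchyP => e e0.
  have e20 : 0 < e / 2 by rewrite divr_gt0.
  have [N hN] := uC _ e20; exists (u N).
  exists N => // n /= Nn; rewrite -ball_normE /ball_ /=.
  apply: le_lt_trans (hN _ _ (leqnn _) Nn) _.
  by rewrite ltr_pdivrMr // ltr_pMr // ltr1n.
move=> /cauchy_cvg /cvg_ex [l /cvgrPdist_le ul]; exists l => e e0.
have [N _ hN] := ul _ e0; exists N => n Nn.
by rewrite distrC; exact: hN.
Qed.

Lemma fast_complete (V : completeNormedModType C) (u : nat -> V) (M : C) :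
  0 <= M -> (forall m n, `|u m - u n| <= M * (rate m + rate n)) ->
  exists l, forall n, `|u n - l| <= M * rate n.
Proof.
move=> M0 uC; have [l ul] := complete_limit (fast_cauchy M0 uC).
by exists l; exact: fast_limit ul.
Qed.

(** The complex numbers are complete because their real and imaginary parts
   are. *)
Lemma fast_completeC (u : nat -> C) (M : C) :
  0 <= M -> (forall m n, `|u m - u n| <= M * (rate m + rate n)) ->
  exists l, forall n, `|u n - l| <= M * rate n.
Proof.
move=> M0 uC; have cau := @fast_cauchy C^o u M M0 uC.
have normIm (z : C) : `|complex.Im z|%:C%C <= `|z|.
  by rewrite -normrN -ReiNIm; apply: le_trans (normc_ge_Re _) _; rewrite normrM complexiE normCi mulr1.
have [a ha] : exists l : R, forall e, 0 < e ->
    exists N, forall n, (N <= n)%N -> `|complex.Re (u n) - l| <= e.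
  apply: (@complete_limit _ R) => e e0; have e0' : 0 < e%:C%C by rewrite ltcR.
  have [N hN] := cau _ e0'; exists N => m n Nm Nn; rewrite -lecR.
  apply: le_trans (hN m n Nm Nn); apply: le_trans (normc_ge_Re _).
  by rewrite raddfB.
have [b hb] : exists l : R, forall e, 0 < e ->
    exists N, forall n, (N <= n)%N -> `|complex.Im (u n) - l| <= e.
  apply: (@complete_limit _ R) => e e0; have e0' : 0 < e%:C%C by rewrite ltcR.
  have [N hN] := cau _ e0'; exists N => m n Nm Nn; rewrite -lecR.
  apply: le_trans (hN m n Nm Nn); apply: le_trans (normIm _).
  by rewrite raddfB.
exists (a +i* b)%C; apply: (@fast_limit C^o) => // e /posC_real [r r0 ->].
have r20 : 0 < r / 2 by rewrite divr_gt0.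
have [N1 h1] := ha _ r20; have [N2 h2] := hb _ r20.
exists (maxn N1 N2) => n; rewrite geq_max => /andP[n1 n2].
rewrite [u n - _]complexE; apply: le_trans (ler_normD _ _) _.
rewrite normrM complexiE normCi mul1r [r]splitr rmorphD !raddfB /=.
have nR (x : R) : `|x%:C%C| = (`|x|)%:C%C.
  by rewrite normc_def /= expr0n addr0 sqrtr_sqr.
by rewrite lerD // -rmorphB nR lecR ?h1 ?h2.
Qed.

End Sequences.

(** * Positive semidefinite forms *)

Section SesquilinearForms.
Context {R : realType}.
Local Notation C := R[i].

Record sform (E : lmodType C) := Sform {
  sf :> E -> E -> C ;
  sf_linear : forall a x y z, sf (a *: x + y) z = a * sf x z + sf y z ;
  sf_conj : forall x y, sf y x = (sf x y)^* ;
  sf_ge0 : forall x, 0 <= sf x x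
}.

Section Theory.
Variables (E : lmodType C) (f : sform E).

Lemma sfDl x y z : f (x + y) z = f x z + f y z.
Proof. by have := sf_linear f 1 x y z; rewrite scale1r mul1r. Qed.

Lemma sf0l z : f 0 z = 0.
Proof. by have /eqP := sfDl 0 0 z; rewrite addr0 -subr_eq0 opprD addrA subrr sub0r oppr_eq0 => /eqP. Qed.

Lemma sfZl a x z : f (a *: x) z = a * f x z.
Proof. by have := sf_linear f a x 0 z; rewrite addr0 sf0l addr0. Qed.

Lemma sfNl x z : f (- x) z = - f x z.
Proof. by rewrite -scaleN1r sfZl mulN1r. Qed.

Lemma sfBl x y z : f (x - y) z = f x z - f y z.
Proof. by rewrite sfDl sfNl. Qed.

Lemma sfDr x y z : f x (y + z) = f x y + f x z.
Proof. by rewrite sf_conj sfDl rmorphD /= -!sf_conj. Qed.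

Lemma sf0r z : f z 0 = 0.
Proof. by rewrite sf_conj sf0l conjC0. Qed.

Lemma sfZr a x z : f x (a *: z) = a^* * f x z.
Proof. by rewrite sf_conj sfZl rmorphM /= -!sf_conj. Qed.

Lemma sfNr x z : f x (- z) = - f x z.
Proof. by rewrite sf_conj sfNl rmorphN /= -sf_conj. Qed.

Lemma sfBr x y z : f x (y - z) = f x y - f x z.
Proof. by rewrite sfDr sfNr. Qed.

Definition seminorm (x : E) : C := sqrtC (f x x).

Local Notation sn := seminorm.

Lemma sn_ge0 x : 0 <= sn x.
Proof. by rewrite sqrtC_ge0 sf_ge0. Qed.

Lemma sn_sqr x : sn x ^+ 2 = f x x.
Proof. exact: sqrtCK. Qed.

Lemma sf_ge0_conj x : (f x x)^* = f x x.
Proof. by rewrite -sf_conj. Qed.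

(** Positivity at x - t * f x y *: y. If f y y = 0 the quadratic term vanishes,
   and a large t forces f x y = 0. *)
Lemma sf_CS_sqr x y : `|f x y| ^+ 2 <= f x x * f y y.
Proof.
have exp t : f (x - t * f x y *: y) (x - t * f x y *: y) =
    f x x - (t + t^*) * `|f x y| ^+ 2 + t * t^* * `|f x y| ^+ 2 * f y y.
  rewrite sfBl !sfBr !sfZl !sfZr (sf_conj f x y) normCK rmorphM /=.
  by ring.
have [y0|y0] := eqVneq (f y y) 0; last first.
  have yp : 0 < f y y by rewrite lt_def y0 sf_ge0.
  have := sf_ge0 f (x - (f y y)^-1 * f x y *: y); rewrite exp.
  rewrite fmorphV /= sf_ge0_conj.
  rewrite [X in 0 <= X](_ : _ = f x x - `|f x y| ^+ 2 / f y y); last by field.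
  by rewrite subr_ge0 ler_pdivrMr.
rewrite y0 mulr0 real_leNgt ?rpredX ?normr_real ?rpred0 //; apply/negP => c0.
set c := `|f x y| ^+ 2 in exp c0.
have cR : c \is Num.real by rewrite rpredX ?normr_real.
have := sf_ge0 f (x - (f x x + 1) / (c *+ 2) * f x y *: y).
have tR : ((f x x + 1) / (c *+ 2))^* = (f x x + 1) / (c *+ 2).
  by apply: conj_Creal; rewrite ger0_real // divr_ge0 ?addr_ge0 ?sf_ge0 // ltW.
rewrite exp tR y0 mulr0 addr0 -mulr2n.
rewrite [_ * c](_ : _ = f x x + 1); last first.
  by field; rewrite gt_eqF.
by rewrite opprD addrA subrr sub0r oppr_ge0 real_leNgt ?ltr01 // ?rpred1 ?rpred0.
Qed.

Lemma sf_CS x y : `|f x y| <= sn x * sn y.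
Proof.
rewrite -ler_sqr ?nnegrE ?mulr_ge0 ?sn_ge0 //.
by rewrite exprMn !sn_sqr sf_CS_sqr.
Qed.

Lemma addC_conj_le (z : C) : z + z^* <= `|z| *+ 2.
Proof.
have zR : z + z^* \is Num.real.
  by apply/CrealP; rewrite rmorphD /= conjCK addrC.
apply: le_trans (real_ler_norm zR) _; apply: le_trans (ler_normD _ _) _.
by rewrite norm_conjC.
Qed.

Lemma snD x y : sn (x + y) <= sn x + sn y.
Proof.
rewrite -ler_sqr ?nnegrE ?addr_ge0 ?sn_ge0 //.
rewrite sn_sqr sqrrD !sn_sqr sfDl !sfDr addrA lerD2r -addrA lerD2l.
rewrite (sf_conj f x y); apply: le_trans (addC_conj_le _) _.
by rewrite lerMn2r sf_CS orbT.
Qed.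

Lemma snZ a x : sn (a *: x) = `|a| * sn x.
Proof.
by rewrite /seminorm sfZl sfZr mulrA -normCK sqrtCM ?nnegrE ?sqrCK ?exprn_ge0 ?sf_ge0.
Qed.

End Theory.
End SesquilinearForms.

(** * Completion of a vector space with a positive semidefinite form *)

Section GNS.
Context {R : realType}.
Local Notation C := R[i].
Variables (E : lmodType C) (f : sform E).
Local Notation sn := (seminorm f).
Implicit Types (g h : E -> C^o) (x y z : E) (e M : C).

Definition near_vec (g : E -> C^o) e x := forall y, `|g y - f x y| <= e * sn y.

(** The completion of E is realised inside the functions on E: a vector x
   becomes its functional f x, and the completion is the closure of these
   functionals for the dual seminorm. *)
Definition approximable_functional (g : E -> C^o) :=
  (forall a x y, g (a *: x + y) = a^* * g x + g y) /\
  (forall e, 0 < e -> exists x, near_vec g e x).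

Definition gns_pred : pred (E -> C^o) := fun g => `[< approximable_functional g >].

Lemma near_vec_bound g e x : 0 <= e -> near_vec g e x ->
  forall y, `|g y| <= (sn x + e) * sn y.
Proof.
move=> e0 gx y; rewrite -(subrK (f x y) (g y)) addrC.
apply: le_trans (ler_normD _ _) _; rewrite mulrDl lerD ?sf_CS //; exact: gx.
Qed.

Lemma sn_bound_self x e : 0 <= e -> (forall y, `|f x y| <= e * sn y) -> sn x <= e.
Proof.
move=> e0 /(_ x); rewrite ger0_norm ?sf_ge0 // -(sn_sqr f) expr2.
have [->|s0] := eqVneq (sn x) 0; first by [].
by rewrite ler_pM2r // lt_def s0 sn_ge0.
Qed.

Lemma near_vec_dist g e d x y : 0 <= e -> 0 <= d ->
  near_vec g e x -> near_vec g d y -> sn (x - y) <= e + d.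
Proof.
move=> e0 d0 gx gy; apply: sn_bound_self => [|z]; first exact: addr_ge0.
rewrite sfBl -(subrKA (g z)) mulrDl; apply: le_trans (ler_normD _ _) _.
by rewrite lerD ?gy // distrC.
Qed.

Lemma near_vec_rep x e : 0 <= e -> near_vec (f x) e x.
Proof. by move=> e0 y; rewrite subrr normr0 mulr_ge0 ?sn_ge0. Qed.

Lemma approximable_rep x : approximable_functional (f x).
Proof.
split=> [a y z|e e0]; first by rewrite sfDr sfZr.
by exists x; exact/near_vec_rep/ltW.
Qed.

Lemma near_vec_lin a g h e d x y : near_vec g e x -> near_vec h d y ->
  near_vec (a *: g + h) (`|a| * e + d) (a *: x + y).
Proof.
move=> gx hy z; rewrite sf_linear.
have -> : (a *: g + h) z - (a * f x z + f y z) = a * (g z - f x z) + (h z - f y z).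
  by rewrite -![(a *: g + h) _]/(a * g _ + h _) mulrBr opprD addrACA.
apply: le_trans (ler_normD _ _) _; rewrite normrM mulrDl -mulrA lerD ?ler_wpM2l //.
Qed.

Lemma gns_submod : submod_closed gns_pred.
Proof.
split.
  apply/asboolP; split=> [a x y|e e0]; first by rewrite mulr0 addr0.
  by exists 0 => y; rewrite sf0l subr0 normr0 mulr_ge0 ?sn_ge0 // ltW.
move=> a g h /asboolP [gl gn] /asboolP [hl hn]; apply/asboolP; split=> [b x y|e e0].
  rewrite -![(a *: g + h) _]/(a * g _ + h _) gl hl.
  by rewrite !mulrDr (mulrCA a) addrACA.
have a0 : 0 < `|a| + 1 by rewrite ltr_wpDl.
have [x gx] := gn (e / 2 / (`|a| + 1)) ltac:(by rewrite !divr_gt0).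
have [y hy] := hn (e / 2) ltac:(by rewrite !divr_gt0).
exists (a *: x + y) => z; apply: le_trans (near_vec_lin _ gx hy z) _.
rewrite ler_wpM2r ?sn_ge0 // [leRHS]splitr lerD2r mulrCA ger_pMr ?divr_gt0 //.
by rewrite ler_pdivrMr // mul1r lerDl.
Qed.

HB.instance Definition _ := GRing.isSubmodClosed.Build _ _ gns_pred gns_submod.

Definition gns := {g : E -> C^o | gns_pred g}.

HB.instance Definition _ := SubChoice.on gns.
HB.instance Definition _ := [SubChoice_isSubLmodule of gns by <:].

Implicit Types u v w : gns.

Lemma gnsP u : approximable_functional (val u).
Proof. exact/asboolP/(valP u). Qed.

Lemma gns_near u e : 0 < e -> exists x, near_vec (val u) e x.
Proof. by move=> e0; have [_ /(_ _ e0)] := gnsP u. Qed.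

Lemma gns_bound u : exists2 M : C, 0 <= M & forall y, `|val u y| <= M * sn y.
Proof.
have [x ux] := gns_near u ltr01; exists (sn x + 1); first by rewrite addr_ge0 ?sn_ge0.
exact: near_vec_bound ux.
Qed.

Lemma gnsB u x y : val u (x - y) = val u x - val u y.
Proof.
have [ul _] := gnsP u.
by rewrite addrC -scaleN1r ul rmorphN1 mulN1r addrC.
Qed.

(** Since val u y is the inner product of u with the vector y, the inner
   product of u and v is the limit of val u y as y tends to v. *)
Definition is_dot u v (c : C) := exists2 M : C, 0 <= M &
  forall e y, 0 < e -> near_vec (val v) e y -> `|val u y - c| <= M * e.

Lemma is_dot_exists u v : exists c, is_dot u v c.
Proof.
have [M M0 uM] := gns_bound u.
have /choice [y vy] : forall n, exists y, near_vec (val v) (rate n) y.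
  by move=> n; exact/gns_near/rate_gt0.
have [c hc] := @fast_completeC R (fun n => val u (y n)) M M0 ltac:(
  move=> m n; rewrite -gnsB; apply: le_trans (uM _) _; apply: ler_wpM2l => //;
  apply: near_vec_dist; rewrite ?rate_ge0 //).
exists c, M => // e z e0 vz; apply: (@le_rate _ _ _ (M *+ 2)).
  by rewrite mulrn_wge0.
move=> n; rewrite -(subrKA (val u (y n))).
apply: le_trans (ler_normD _ _) _; rewrite mulrnAl mulr2n addrA lerD ?hc //.
rewrite -gnsB; apply: le_trans (uM _) _; rewrite -mulrDr ler_wpM2l //.
by apply: near_vec_dist; rewrite ?rate_ge0 ?(ltW e0).
Qed.

Lemma is_dot_unique u v c d : is_dot u v c -> is_dot u v d -> c = d.
Proof.
move=> [M M0 hM] [N N0 hN]; apply/eqP; rewrite -subr_eq0 -normr_le0.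
apply: (@le_rate _ _ _ (M + N)); first exact: addr_ge0.
move=> n; have [y vy] := gns_near v (rate_gt0 n).
rewrite add0r -(subrKA (val u y)); apply: le_trans (ler_normD _ _) _.
by rewrite mulrDl lerD // ?hN ?rate_gt0 // distrC hM ?rate_gt0.
Qed.

Definition gdot u v : C := sval (cid (is_dot_exists u v)).

Lemma gdotP u v : is_dot u v (gdot u v).
Proof. by rewrite /gdot; case: cid. Qed.

Lemma gdotE u v c : is_dot u v c -> gdot u v = c.
Proof. exact/is_dot_unique/gdotP. Qed.

Lemma gdot_linear a u v w : gdot (a *: u + v) w = a * gdot u w + gdot v w.
Proof.
apply: gdotE; have [M M0 hM] := gdotP u w; have [N N0 hN] := gdotP v w.
exists (`|a| * M + N); first by rewrite addr_ge0 ?mulr_ge0.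
move=> e y e0 wy.
have -> : val (a *: u + v) y = a * val u y + val v y by [].
rewrite opprD addrACA -mulrBr; apply: le_trans (ler_normD _ _) _.
by rewrite normrM mulrDl -mulrA lerD ?ler_wpM2l ?hM ?hN.
Qed.

Lemma gdot_conj u v : gdot v u = (gdot u v)^*.
Proof.
apply: gdotE; have [M M0 hM] := gdotP u v; have [N N0 hN] := gns_bound v.
have [y0 vy0] := gns_near v ltr01.
have B0 : 0 <= sn y0 + 2 by rewrite addr_ge0 ?sn_ge0.
exists (sn y0 + 2) => // e x e0 ux; apply: (@le_rate _ _ _ (sn x + M)).
  by rewrite addr_ge0 ?sn_ge0.
move=> n; have [y vy] := gns_near v (rate_gt0 n).
have n1 : rate n <= 1 :> C by rewrite invf_le1 ?ltr0Sn // ler1n.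
have A : `|f y x - (gdot u v)^*| <= (sn y0 + 2) * e + M * rate n.
  rewrite (sf_conj f x y) -rmorphB norm_conjC -(subrKA (val u y)).
  apply: le_trans (ler_normD _ _) _; rewrite lerD ?hM ?rate_gt0 //.
  rewrite distrC; apply: le_trans (ux _) _; rewrite mulrC ler_wpM2r ?(ltW e0) //.
  rewrite -(subrK y0 y) addrC; apply: le_trans (snD _ _ _) _; rewrite lerD2l.
  apply: le_trans (near_vec_dist (rate_ge0 n) ler01 vy vy0) _.
  by rewrite [2]mulr2n lerD2r.
rewrite -(subrKA (f y x)); apply: le_trans (ler_normD _ _) _.
apply: le_trans (lerD (vy x) A) _.
by apply: eqle; ring.
Qed.

Lemma gdot_rep u x : forall w, val w = f x :> (E -> C^o) -> gdot u w = val u x.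
Proof.
move=> w wx; apply: gdotE; have [M M0 hM] := gns_bound u.
exists M => // e y e0; rewrite wx => xy; rewrite -gnsB.
apply: le_trans (hM _) _; apply: ler_wpM2l => //.
have := near_vec_dist (ltW e0) (lexx 0) xy (near_vec_rep x (lexx 0)).
by rewrite addr0.
Qed.

Lemma ge0_limit (c M : C) : 0 <= M ->
  (forall n, exists2 r, 0 <= r & `|c - r| <= M * rate n) -> 0 <= c.
Proof.
move=> M0 h; suff -> : c = `|c| by [].
apply/eqP; rewrite -subr_eq0 -normr_le0; apply: (@le_rate _ _ _ (M *+ 2)).
  by rewrite mulrn_wge0.
move=> n; have [r r0 cr] := h n; rewrite add0r -(subrKA r) mulrnAl mulr2n.
apply: le_trans (ler_normD _ _) _; rewrite lerD // -[in `|r - _|](ger0_norm r0).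
by apply: le_trans (ler_dist_dist _ _) _; rewrite distrC.
Qed.

Lemma gdot_near u : exists2 K : C, 0 <= K & forall n, exists2 y,
  near_vec (val u) (rate n) y & `|gdot u u - f y y| <= K * rate n.
Proof.
have [M M0 hM] := gdotP u u; have [N N0 uN] := gns_bound u.
exists (M + N + 1); first by rewrite !addr_ge0.
move=> n; have [y uy] := gns_near u (rate_gt0 n); exists y => //.
have n1 : rate n <= 1 :> C by rewrite invf_le1 ?ltr0Sn // ler1n.
have yN : sn y <= N + 1.
  apply: sn_bound_self => [|z]; first exact: addr_ge0.
  rewrite -(subrK (val u z) (f y z)) addrC; apply: le_trans (ler_normD _ _) _.
  rewrite mulrDl lerD // distrC; apply: le_trans (uy z) _.
  by rewrite ler_wpM2r ?sn_ge0.
rewrite -(subrKA (val u y)); apply: le_trans (ler_normD _ _) _.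
rewrite -addrA [leRHS]mulrDl lerD //; first by rewrite distrC hM ?rate_gt0.
by apply: le_trans (uy y) _; rewrite mulrC ler_wpM2r ?rate_ge0.
Qed.

Lemma gdot_ge0 u : 0 <= gdot u u.
Proof.
have [K K0 hK] := gdot_near u; apply: (ge0_limit K0) => n.
by have [y _ h] := hK n; exists (f y y); rewrite ?sf_ge0.
Qed.

Definition gform := Sform gdot_linear gdot_conj gdot_ge0.

Local Notation gn := (seminorm gform).

Lemma gns_norm_le u e : 0 <= e -> (forall y, `|val u y| <= e * sn y) -> gn u <= e.
Proof.
move=> e0 ue; rewrite -ler_sqr ?nnegrE ?sn_ge0 // sn_sqr /=.
have [K K0 hK] := gdot_near u.
apply: (@le_rate _ _ _ (K + (e *+ 2 + 1))); first by rewrite !addr_ge0 ?mulrn_wge0.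
move=> n; have [y uy hy] := hK n.
have n1 : rate n <= 1 :> C by rewrite invf_le1 ?ltr0Sn // ler1n.
have yN : sn y <= e + rate n.
  apply: sn_bound_self => [|z]; first by rewrite addr_ge0 ?rate_ge0.
  rewrite -(subrK (val u z) (f y z)) addrC; apply: le_trans (ler_normD _ _) _.
  by rewrite mulrDl lerD // distrC; exact: uy.
rewrite -[gdot u u](ger0_norm (gdot_ge0 u)) -(subrK (f y y) (gdot u u)).
apply: le_trans (ler_normD _ _) _; rewrite mulrDl addrCA lerD //.
rewrite (ger0_norm (sf_ge0 _ _)) -(sn_sqr f).
apply: le_trans (_ : (e + rate n) ^+ 2 <= _).
  by rewrite ler_sqr ?nnegrE ?sn_ge0 ?addr_ge0 ?rate_ge0.
rewrite sqrrD -addrA lerD2l mulrDl mulrnAl lerD2l expr2.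
by rewrite mul1r ger_pMl ?rate_gt0.
Qed.

Lemma gns_norm_bound u y : `|val u y| <= gn u * sn y.
Proof.
pose w : gns := exist _ (f y : E -> C^o) (asboolT (approximable_rep y)).
rewrite -(@gdot_rep u y w erefl) -[gdot u w]/(gform u w).
apply: le_trans (sf_CS _ _ _) _; rewrite ler_wpM2l ?sn_ge0 //.
apply: gns_norm_le (sn_ge0 _ _) _ => z; exact: sf_CS.
Qed.

Lemma gns_norm0 u : gn u = 0 -> u = 0.
Proof.
move=> u0; apply/val_inj/funext => y; apply/eqP; rewrite -normr_le0.
by apply: le_trans (gns_norm_bound u y) _; rewrite u0 mul0r.
Qed.

HB.instance Definition _ := @Lmodule_isNormed.Build C gns gn
  (snD gform) (snZ gform) gns_norm0.

Lemma gns_complete (F : set_system gns) : ProperFilter F -> cauchy F -> cvg F.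
Proof.
move=> PF /cauchyP cF.
have /choice [u hu] : forall n, exists u : gns, F (ball u (rate n : C)).
  by move=> n; have [u] := cF (rate n) (rate_gt0 n); exists u.
have uC m n : `|u m - u n| <= rate m + rate n.
  have /filter_ex [z []] : F (ball (u m) (rate m) `&` ball (u n) (rate n)).
    exact: filterI.
  rewrite -!ball_normE /ball_ /= => mz nz.
  rewrite -(subrKA z); apply: le_trans (ler_normD _ _) _.
  by rewrite lerD ?ltW // distrC.
have uyC y m n : `|val (u m) y - val (u n) y| <= sn y * (rate m + rate n).
  have -> : val (u m) y - val (u n) y = val (u m - u n) y by [].
  by apply: le_trans (gns_norm_bound _ y) _; rewrite mulrC ler_wpM2l ?sn_ge0 // uC.
have /choice [l hl] : forall y, exists l : C, forall n,
    `|val (u n) y - l| <= sn y * rate n.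
  move=> y; have [l hl] := fast_completeC (sn_ge0 _ y) (uyC y).
  by exists l.
have lP : approximable_functional l.
  split=> [a x y|e e0].
    apply/eqP; rewrite -subr_eq0 -normr_le0.
    pose M := sn (a *: x + y) + (`|a| * sn x + sn y).
    have M0 : 0 <= M by rewrite !addr_ge0 ?mulr_ge0 ?sn_ge0.
    apply: (le_rate M0) => n; have [ul _] := gnsP (u n).
    rewrite add0r -(subrKA (val (u n) (a *: x + y))) {2}ul.
    apply: le_trans (ler_normD _ _) _; rewrite mulrDl lerD //; first by rewrite distrC.
    rewrite opprD addrACA -mulrBr; apply: le_trans (ler_normD _ _) _.
    by rewrite mulrDl lerD // normrM norm_conjC -mulrA ler_wpM2l.
  have e20 : 0 < e / 2 by rewrite divr_gt0.
  have [N /(_ N (leqnn _)) hN] := rate_le_nat e20.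
  have [x ux] := gns_near (u N) e20; exists x => y.
  rewrite -(subrKA (val (u N) y)); apply: le_trans (ler_normD _ _) _.
  rewrite [e]splitr mulrDl lerD //.
  by rewrite distrC; apply: le_trans (hl _ _) _; rewrite mulrC ler_wpM2r ?sn_ge0.
pose w : gns := exist _ (l : E -> C^o) (asboolT lP).
have uw n : `|u n - w| <= rate n.
  by apply: gns_norm_le => [|y]; [exact: rate_ge0 | rewrite mulrC; exact: hl].
apply/cvg_ex; exists w; apply/cvgrPdist_le => e e0 /=.
have e20 : 0 < e / 2 by rewrite divr_gt0.
have [N /(_ N (leqnn _)) hN] := rate_le_nat e20.
apply: filterS (hu N) => z; rewrite -ball_normE /ball_ /= => Nz.
rewrite -(subrKA (u N)); apply: le_trans (ler_normD _ _) _.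
by rewrite [e]splitr lerD //; [rewrite distrC (le_trans (uw N))|rewrite (le_trans (ltW Nz))].
Qed.

HB.instance Definition _ := Uniform_isComplete.Build gns gns_complete.

Fact gdot_bilinear : bilinear_for *%R (Num.conj \; *%R) (gdot : gns -> gns -> C).
Proof.
split=> [w a u v|w a u v]; first exact: gdot_linear.
exact: etrans (sfDr gform _ _ _) (congr1 (+%R^~ _) (sfZr gform _ _ _)).
Qed.

HB.instance Definition _ := bilinear_isBilinear.Build C gns gns C *%R
  (Num.conj \; *%R) gdot gdot_bilinear.

Fact gdot_hermitian (u v : gns) : gdot u v = (-1) ^+ false * (gdot v u)^*.
Proof. by rewrite expr0 mul1r -gdot_conj. Qed.

HB.instance Definition _ := isHermitianSesquilinear.Build C gns false Num.conj
  gdot gdot_hermitian.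

Fact gdot_gt0 (u : gns) : u != 0 -> 0 < gdot u u.
Proof.
move=> u0; rewrite lt_def gdot_ge0 andbT; apply: contra u0 => /eqP u0.
by apply/eqP/gns_norm0; rewrite /seminorm /= u0 sqrtC0.
Qed.

HB.instance Definition _ := isDotProduct.Build C gns gdot gdot_gt0.

Fact gdot_norm (u : gns) : gdot u u = `|u| ^+ 2.
Proof. by rewrite [RHS](sn_sqr gform u). Qed.

HB.instance Definition _ := NormedModule_isHilbert.Build R gns gdot_norm.

Definition gns_rep (x : E) : gns := exist _ (f x : E -> C^o) (asboolT (approximable_rep x)).

Fact gns_rep_linear : linear gns_rep.
Proof. by move=> a x y; apply/val_inj/funext => z; exact: sf_linear. Qed.

HB.instance Definition _ := GRing.isLinear.Build C E gns _ gns_rep gns_rep_linear.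

(** Null vectors are divided out and limits are added in one step. All the
   spaces constructed below (sums, direct limits, defect spaces and the spaces
   carrying Blaschke roots) come from this theorem, applied to a form on a
   concrete vector space. *)
Theorem hilbert_completion : exists (K : hilbertType R) (i : {linear E -> K}),
  (forall x y, hdot (i x) (i y) = f x y) /\
  (forall (y : K) e, 0 < e -> exists x, `|y - i x| <= e).
Proof.
exists gns, gns_rep; split=> [x y|u e e0]; first exact: gdot_rep.
by have [x ux] := gns_near u e0; exists x; apply: gns_norm_le; first exact: ltW.
Qed.

End GNS.

(** * Contractions and isometries between Hilbert spaces *)

Section HilbertSpaces.
Context {R : realType}.
Local Notation C := R[i].
Implicit Types H K L : hilbertType R.

Definition mklinear (U V : lmodType C) (f : U -> V) (fl : linear f) : {linear U -> V} :=
  HB.pack f (GRing.isLinear.Build C U V _ f fl).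

Lemma mklinearE (U V : lmodType C) (f : U -> V) (fl : linear f) x : mklinear fl x = f x.
Proof. by []. Qed.

Section Dot.
Variable H : hilbertType R.
Implicit Types x y z : H.

Fact hdot_linear a x y z : hdot (a *: x + y) z = a * hdot x z + hdot y z.
Proof. by rewrite linearDl /= linearZl_LR. Qed.

Lemma hdotC x y : hdot y x = (hdot x y)^*.
Proof. by rewrite [LHS]hermitian_subproof expr0 mul1r. Qed.

Fact hdot_ge0 x : 0 <= hdot x x.
Proof. by rewrite hdot_norm exprn_ge0. Qed.

Definition hform : sform H := Sform hdot_linear hdotC hdot_ge0.

Lemma sn_hform x : seminorm hform x = `|x|.
Proof. by rewrite /seminorm /= hdot_norm sqrCK. Qed.

Lemma hdotDl x y z : hdot (x + y) z = hdot x z + hdot y z.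
Proof. exact: (sfDl hform). Qed.
Lemma hdotDr x y z : hdot x (y + z) = hdot x y + hdot x z.
Proof. exact: (sfDr hform). Qed.
Lemma hdotBl x y z : hdot (x - y) z = hdot x z - hdot y z.
Proof. exact: (sfBl hform). Qed.
Lemma hdotBr x y z : hdot x (y - z) = hdot x y - hdot x z.
Proof. exact: (sfBr hform). Qed.
Lemma hdotNl x z : hdot (- x) z = - hdot x z.
Proof. exact: (sfNl hform). Qed.
Lemma hdotZl a x z : hdot (a *: x) z = a * hdot x z.
Proof. exact: (sfZl hform). Qed.
Lemma hdotZr a x z : hdot x (a *: z) = a^* * hdot x z.
Proof. exact: (sfZr hform). Qed.
Lemma hdot0l x : hdot 0 x = 0.
Proof. exact: (sf0l hform). Qed.
Lemma hdot0r x : hdot x 0 = 0.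
Proof. exact: (sf0r hform). Qed.

Lemma hdot_CS x y : `|hdot x y| <= `|x| * `|y|.
Proof. by have := sf_CS hform x y; rewrite !sn_hform. Qed.

Lemma hnormZ a x : `|a *: x| = `|a| * `|x|.
Proof. exact: normrZ. Qed.

Lemma hnormD_sqr x y : `|x + y| ^+ 2 = `|x| ^+ 2 + (hdot x y + (hdot x y)^*) + `|y| ^+ 2.
Proof. by rewrite -!hdot_norm hdotDl !hdotDr (hdotC x y) !addrA. Qed.

Lemma hnormD_orth x y : hdot x y = 0 -> `|x + y| ^+ 2 = `|x| ^+ 2 + `|y| ^+ 2.
Proof. by move=> xy; rewrite hnormD_sqr xy conjC0 !addr0. Qed.

Lemma hdot_eq0 x : (forall y, hdot x y = 0) -> x = 0.
Proof.
by move=> /(_ x) /eqP; rewrite hdot_norm sqrf_eq0 normr_eq0 => /eqP.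
Qed.
End Dot.

Definition isometric H K (f : H -> K) := forall x, `|f x| = `|x|.

(** The norms at x + y and x + 'i y determine the real and the imaginary part of
   the inner product. *)
Lemma isometric_hdot H K (f : {linear H -> K}) : isometric f ->
  forall x y, hdot (f x) (f y) = hdot x y.
Proof.
move=> fi x y.
have key a : a^* * hdot (f x) (f y) + (a^* * hdot (f x) (f y))^* =
             a^* * hdot x y + (a^* * hdot x y)^*.
  have := fi (x + a *: y) => /(congr1 (fun z => z ^+ 2)).
  rewrite linearD /= !hnormD_sqr !fi linearZ /= !hdotZr.
  by move=> /addIr /addrI.
have k1 := key 1; have ki := key 'i.
rewrite !rmorph1 !mul1r in k1.
rewrite conjCi !mulNr !rmorphN !rmorphM /= conjCi in ki.
set p := hdot (f x) (f y) in k1 ki *; set q := hdot x y in k1 ki *.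
have k2 : p - p^* = q - q^*.
  apply: (mulfI (neq0Ci C)); apply: oppr_inj.
  rewrite !mulrBr !opprB addrC [RHS]addrC.
  by move: ki; rewrite !mulNr !opprK.
have : p *+ 2 = q *+ 2.
  transitivity ((p + p^*) + (p - p^*)); first by ring.
  by rewrite k1 k2; ring.
by move=> /eqP; rewrite eqrMn2r => /orP[//|/eqP].
Qed.

Definition dense_map (E : lmodType C) K (i : E -> K) :=
  forall y e, 0 < e -> exists x, `|y - i x| <= e.

Definition nonexpansive H K (f : H -> K) := forall x, `|f x| <= `|x|.

Lemma isometric_nonexpansive H K (f : H -> K) : isometric f -> nonexpansive f.
Proof. by move=> fi x; rewrite fi. Qed.

Lemma nonexpansive_comp H K L (f : K -> L) (g : H -> K) :
  nonexpansive f -> nonexpansive g -> nonexpansive (f \o g).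
Proof. by move=> fc gc x; apply: le_trans (fc _) (gc _). Qed.

Lemma isometric_comp H K L (f : K -> L) (g : H -> K) :
  isometric f -> isometric g -> isometric (f \o g).
Proof. by move=> fc gc x; rewrite /= fc gc. Qed.

Lemma dense_eq (E : lmodType C) K L (i : E -> K) (f g : {linear K -> L}) (M N : C) :
  dense_map i -> 0 <= M -> 0 <= N -> (forall x, `|f x| <= M * `|x|) ->
  (forall x, `|g x| <= N * `|x|) -> (forall x, f (i x) = g (i x)) -> forall x, f x = g x.
Proof.
move=> id M0 N0 fM gN fg x; apply/eqP; rewrite -subr_eq0 -normr_le0.
apply: (@le_rate _ _ _ (M + N)); first exact: addr_ge0.
move=> n; have [y xy] := id x _ (rate_gt0 n).
rewrite add0r -(subrKA (f (i y))) {2}fg -!linearB.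
apply: le_trans (ler_normD _ _) _; rewrite mulrDl lerD //.
  by apply: le_trans (fM _) _; rewrite ler_wpM2l.
by apply: le_trans (gN _) _; rewrite ler_wpM2l // distrC.
Qed.

Lemma dense_isometric (E : lmodType C) K L (i : E -> K) (f : {linear K -> L}) :
  dense_map i -> nonexpansive f -> (forall x, `|f (i x)| = `|i x|) -> isometric f.
Proof.
move=> id fc fi x; apply/le_anti; rewrite fc /=.
apply: (@le_rate _ _ _ 2) => // n; have [y xy] := id x _ (rate_gt0 n).
have fxy : `|f (i y) - f x| <= rate n by rewrite -linearB (le_trans (fc _)) // distrC.
rewrite -[X in `|X| <= _](subrK (i y)); apply: le_trans (ler_normD _ _) _.
rewrite -fi -[f (i y)](subrK (f x)).
apply: le_trans (lerD xy (le_trans (ler_normD _ _) (lerD fxy (lexx _)))) _.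
by apply: eqle; rewrite mulr_natl mulr2n addrA addrC.
Qed.

Section Douglas.
Variables (E : lmodType C) (Q L : hilbertType R).
Variables (g : {linear E -> Q}) (f : {linear E -> L}).

Let almost_projection (y : Q) (e : C) (x : E) :=
  forall x', `|hdot (y - g x) (g x')| <= e * `|g x'|.

Lemma almost_minimizer (y : Q) (e : C) : 0 < e ->
  exists x, forall x', `|y - g x| ^+ 2 <= `|y - g x'| ^+ 2 + e.
Proof.
move=> /posC_real [r r0 ->]; pose S := [set complex.Re (`|y - g x| ^+ 2) | x in [set: E]].
have ReE (z : Q) : (complex.Re (`|z| ^+ 2))%:C%C = `|z| ^+ 2.
  by rewrite RRe_real // rpredX ?normr_real.
have Sinf : has_inf S.
  split; first by exists (complex.Re (`|y - g 0| ^+ 2)); exists 0.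
  by exists 0 => _ [x _ <-]; rewrite -lecR ReE exprn_ge0.
have [_ [x _ <-] hx] := inf_adherent r0 Sinf.
exists x => x'; rewrite -ReE -[X in _ <= X + _]ReE -rmorphD lecR.
apply: le_trans (ltW hx) _; rewrite lerD2r.
by apply: ge_inf; [case: Sinf | exists x'].
Qed.

(** The first variation at a point whose squared distance to y is within e^2 of
   the infimum. *)
Lemma almost_projection_exists y e : 0 < e -> exists x, almost_projection y e x.
Proof.
move=> e0; have [x hx] := almost_minimizer y (exprn_gt0 2 e0); exists x => x'.
have [w0|w0] := eqVneq `|g x'| 0; first by rewrite (le_trans (hdot_CS _ _)) // w0 !mulr0.
have wp : 0 < `|g x'| by rewrite lt_def w0 normr_ge0.
rewrite -ler_sqr ?nnegrE ?mulr_ge0 ?(ltW e0) //.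
have {}hx t : `|y - g x| ^+ 2 <= `|y - g x + t *: g x'| ^+ 2 + e ^+ 2.
  apply: le_trans (hx (x - t *: x')) _.
  by rewrite linearB linearZ /= opprB addrCA addrC.
move: (y - g x) hx => z hx; set a := hdot _ _.
have := hx (- (a / `|g x'| ^+ 2)); rewrite hnormD_sqr hdotZr -/a hnormZ.
rewrite rmorphN rmorphM fmorphV /= rmorphXn /= (conj_Creal (normr_real _)).
rewrite normrN normrM normfV normrX normr_id.
have -> : `|z| ^+ 2 + (- (a^* / `|g x'| ^+ 2) * a + (- (a^* / `|g x'| ^+ 2) * a)^*)
   + (`|a| / `|g x'| ^+ 2 * `|g x'|) ^+ 2 = `|z| ^+ 2 - `|a| ^+ 2 / `|g x'| ^+ 2.
  rewrite !mulNr rmorphN !rmorphM fmorphV /= conjCK rmorphXn /= (conj_Creal (normr_real _)).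
  by rewrite !exprMn !normCK; field.
by rewrite -addrA lerDl addrC subr_ge0 ler_pdivrMr ?exprn_gt0 // exprMn.
Qed.

(** A map dominated by g on a vector space factors contractively through g.
   The value at y is the limit of f x when g x approaches the projection of y
   to the closure of the range of g. *)
Lemma douglas : (forall x, `|f x| <= `|g x|) ->
  exists F : {linear Q -> L}, (forall x, F (g x) = f x) /\ nonexpansive F.
Proof.
move=> fg.
have close y e d x x' : 0 <= e -> 0 <= d -> almost_projection y e x ->
    almost_projection y d x' -> `|f x - f x'| <= e + d.
  move=> e0 d0 hx hx'; rewrite -linearB; apply: le_trans (fg _) _.
  have [->|w0] := eqVneq `|g (x - x')| 0; first exact: addr_ge0.
  have wp : 0 < `|g (x - x')| by rewrite lt_def w0 normr_ge0.
  rewrite -(ler_pM2r wp) -expr2 -hdot_norm -[hdot _ _]ger0_norm ?hdot_ge0 //.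
  rewrite {1}linearB /= -(subrKA y) hdotDl -[g x - y]opprB hdotNl.
  apply: le_trans (ler_normD _ _) _.
  by rewrite normrN mulrDl lerD ?hx ?hx'.
have ex y : exists q, forall e x, 0 < e -> almost_projection y e x -> `|f x - q| <= e.
  have /choice [x hx] : forall n, exists x, almost_projection y (rate n) x.
    by move=> n; exact/almost_projection_exists/rate_gt0.
  have [q hq] := @fast_complete R L (fun n => f (x n)) 1 ler01 ltac:(
    move=> m n; rewrite mul1r; apply: close (hx m) (hx n); exact: rate_ge0).
  exists q => e z e0 hz; apply: (@le_rate _ _ _ 2) => // n.
  rewrite -(subrKA (f (x n))); apply: le_trans (ler_normD _ _) _.
  rewrite mulr_natl mulr2n addrA; apply: lerD; last by rewrite -[rate n]mul1r.
  exact: close (ltW e0) (rate_ge0 _) hz (hx n).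
have /choice [F hF] := ex.
have Fu y q (M : C) : 0 <= M -> (forall n, exists2 x, almost_projection y (M * rate n) x &
    `|f x - q| <= M * rate n) -> F y = q.
  move=> M0 h; apply/eqP; rewrite -subr_eq0 -normr_le0.
  apply: (@le_rate _ _ _ ((M + 1) *+ 2)); first by rewrite mulrn_wge0 // addr_ge0.
  move=> n; have [x xy fx] := h n; rewrite add0r -(subrKA (f x)).
  apply: le_trans (ler_normD _ _) _; rewrite mulrnAl mulr2n lerD //.
    rewrite distrC; apply: hF; first by rewrite mulr_gt0 ?rate_gt0 ?ltr_wpDl.
    by move=> x'; apply: le_trans (xy _) _; rewrite ler_wpM2r // ler_wpM2r ?rate_ge0 ?lerDl.
  by apply: le_trans fx _; rewrite ler_wpM2r ?rate_ge0 ?lerDl.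
have Fl : linear F.
  move=> a y z; apply: (Fu _ _ (`|a| + 1)); first exact: addr_ge0.
  move=> n; have [x hx] := almost_projection_exists y (rate_gt0 n).
  have [x' hx'] := almost_projection_exists z (rate_gt0 n).
  exists (a *: x + x').
    move=> w; rewrite linearP opprD addrACA -scalerBr hdotDl hdotZl.
    apply: le_trans (ler_normD _ _) _.
    by rewrite normrM !mulrDl mul1r -!mulrA lerD ?ler_wpM2l ?hx ?hx'.
  rewrite linearP opprD addrACA -scalerBr; apply: le_trans (ler_normD _ _) _.
  by rewrite hnormZ mulrDl mul1r lerD ?ler_wpM2l ?hF ?rate_gt0.
exists (mklinear Fl); split=> [x|y] /=.
  by apply: (Fu _ _ 0) => // n; exists x => [x'|]; rewrite subrr ?hdot0l normr0 !mul0r.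
apply: (@le_rate _ _ _ 2) => // n.
have [x hx] := almost_projection_exists y (rate_gt0 n).
rewrite -(subrK (f x) (F y)); apply: le_trans (ler_normD _ _) _.
rewrite distrC mulr_natl mulr2n addrCA lerD ?hF ?rate_gt0 //.
apply: le_trans (fg x) _.
have [->|w0] := eqVneq `|g x| 0; first by rewrite addr_ge0 ?rate_ge0.
have wp : 0 < `|g x| by rewrite lt_def w0 normr_ge0.
rewrite -(ler_pM2r wp) -expr2 -hdot_norm -[hdot _ _]ger0_norm ?hdot_ge0 //.
rewrite -{1}[g x](subrK y) hdotDl -[g x - y]opprB hdotNl.
apply: le_trans (ler_normD _ _) _; rewrite addrC mulrDl normrN lerD ?hx //.
exact: hdot_CS.
Qed.
End Douglas.

Lemma dense_extend (E : lmodType C) K L (i : {linear E -> K}) (f : {linear E -> L}) :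
  dense_map i -> (forall x, `|f x| <= `|i x|) ->
  exists F : {linear K -> L}, [/\ forall x, F (i x) = f x, nonexpansive F &
    (forall x, `|f x| = `|i x|) -> isometric F].
Proof.
move=> id fi; have [F [Fi Fc]] := douglas fi; exists F; split=> // fi'.
by apply: (dense_isometric id Fc) => x; rewrite Fi fi'.
Qed.

(** A contractive left inverse of an isometry is its adjoint: comparing norms
   at x + t *: j h, for all scalars t, forces equality of the linear terms. *)
Lemma left_inverse_adjoint H K (j : {linear H -> K}) (p : {linear K -> H}) :
  isometric j -> nonexpansive p -> (forall h, p (j h) = h) ->
  forall x h, hdot (p x) h = hdot x (j h).
Proof.
move=> ji pc pj x h; set a := hdot (p x) h - hdot x (j h).
suff : a = 0 by move=> /eqP; rewrite subr_eq0 => /eqP.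
have key (t : C) : t^* * a + (t^* * a)^* <= `|x| ^+ 2.
  have := pc (x + t *: j h).
  rewrite -ler_sqr ?nnegrE // linearD linearZ /= pj !hnormD_sqr !hnormZ ji.
  rewrite !hdotZr lerD2r.
  set u := t^* * hdot (p x) h; set v := t^* * hdot x (j h).
  have -> : t^* * a = u - v by rewrite mulrBr.
  rewrite rmorphB /= addrACA -opprD lerBlDr => h1.
  by apply: le_trans h1; rewrite lerDr exprn_ge0.
apply/eqP; rewrite -normr_eq0 -sqrf_eq0; apply/negPn/negP => a0.
have ap : 0 < `|a| ^+ 2 by rewrite lt_def a0 exprn_ge0.
have := key ((`|x| ^+ 2 + 1) / `|a| ^+ 2 * a).
rewrite rmorphM /= -mulrA [a^* * a]mulrC -normCK.
rewrite conj_Creal ?ger0_real ?divr_ge0 ?addr_ge0 ?exprn_ge0 //.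
rewrite divfK ?gt_eqF // conj_Creal ?ger0_real ?addr_ge0 ?exprn_ge0 //.
rewrite lt_geF // -addrA ltrDl addr_gt0 // ltr_wpDl // exprn_ge0.
Qed.

End HilbertSpaces.

(** * Finitely supported sequences *)

Section DependentSequences.
Context {R : realType}.
Local Notation C := R[i].
Variable F : nat -> lmodType C.

(** The n-th term lives in a space that depends on n: the sums formed below have
   different summands. *)
Definition dseq := forall n, F n.

HB.instance Definition _ := gen_eqMixin dseq.
HB.instance Definition _ := gen_choiceMixin dseq.

Let dadd (x y : dseq) : dseq := fun n => x n + y n.
Let dopp (x : dseq) : dseq := fun n => - x n.
Let dzero : dseq := fun n => 0.
Let dscale (a : C) (x : dseq) : dseq := fun n => a *: x n.

Fact dseq_addA : associative dadd.
Proof. by move=> x y z; apply: functional_extensionality_dep => n; exact: addrA. Qed.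
Fact dseq_addC : commutative dadd.
Proof. by move=> x y; apply: functional_extensionality_dep => n; exact: addrC. Qed.
Fact dseq_add0 : left_id dzero dadd.
Proof. by move=> x; apply: functional_extensionality_dep => n; exact: add0r. Qed.
Fact dseq_addN : left_inverse dzero dopp dadd.
Proof. by move=> x; apply: functional_extensionality_dep => n; exact: addNr. Qed.

HB.instance Definition _ :=
  GRing.isZmodule.Build dseq dseq_addA dseq_addC dseq_add0 dseq_addN.

Fact dseq_scaleA a b x : dscale a (dscale b x) = dscale (a * b) x.
Proof. by apply: functional_extensionality_dep => n; exact: scalerA. Qed.
Fact dseq_scale1 : left_id 1 dscale.
Proof. by move=> x; apply: functional_extensionality_dep => n; exact: scale1r. Qed.
Fact dseq_scaleDr : right_distributive dscale +%R.
Proof. by move=> a x y; apply: functional_extensionality_dep => n; exact: scalerDr. Qed.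
Fact dseq_scaleDl x : {morph dscale^~ x : a b / a + b}.
Proof. by move=> a b; apply: functional_extensionality_dep => n; exact: scalerDl. Qed.

HB.instance Definition _ := GRing.Zmodule_isLmodule.Build C dseq
  dseq_scaleA dseq_scale1 dseq_scaleDr dseq_scaleDl.

Definition vanishes_from (x : dseq) N := forall n, (N <= n)%N -> x n = 0.

Definition fsum_pred : pred dseq := fun x => `[< exists N, vanishes_from x N >].

Lemma fsum_submod : submod_closed fsum_pred.
Proof.
split; first by apply/asboolP; exists 0%N.
move=> a x y /asboolP [M xM] /asboolP [N yN]; apply/asboolP; exists (maxn M N) => n.
rewrite geq_max => /andP[Mn Nn]; rewrite -[(a *: x + y) n]/(a *: x n + y n).
by rewrite xM // yN // scaler0 addr0.
Qed.

HB.instance Definition _ := GRing.isSubmodClosed.Build _ _ fsum_pred fsum_submod.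

Definition fsum := {x : dseq | fsum_pred x}.

HB.instance Definition _ := SubChoice.on fsum.
HB.instance Definition _ := [SubChoice_isSubLmodule of fsum by <:].

Implicit Types x y : fsum.

Lemma fsumP x : exists N, vanishes_from (val x) N.
Proof. exact/asboolP/(valP x). Qed.

Definition supp x : nat := sval (cid (fsumP x)).

Lemma suppP x : vanishes_from (val x) (supp x).
Proof. by rewrite /supp; case: cid. Qed.

Lemma dfwith0_vanishes n (u : F n) :
  vanishes_from (@eqtype.dfwith nat (fun k => F k) (fun _ => 0) n u : dseq) n.+1.
Proof. by move=> m nm; rewrite eqtype.dfwith_out // ltn_eqF. Qed.

Definition single n (u : F n) : fsum :=
  locked (exist _ (@eqtype.dfwith nat (fun k => F k) (fun _ => 0) n u : dseq)
    (asboolT (ex_intro _ n.+1 (dfwith0_vanishes u)))).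

Lemma single_in n (u : F n) : val (single u) n = u.
Proof. by rewrite /single -lock; exact: eqtype.dfwith_in. Qed.

Lemma single_out n m (u : F n) : n != m -> val (single u) m = 0.
Proof. by move=> nm; rewrite /single -lock; exact: eqtype.dfwith_out. Qed.

Lemma single_vanishes n (u : F n) : vanishes_from (val (single u)) n.+1.
Proof. by move=> m nm; rewrite single_out // ltn_eqF. Qed.

Fact single_linear n : linear (@single n).
Proof.
move=> a u v; apply/val_inj/functional_extensionality_dep => m.
rewrite -[RHS]/(a *: val (single u) m + val (single v) m).
have [e|nm] := eqVneq n m; last by rewrite !single_out // scaler0 addr0.
by case: m / e; rewrite !single_in.
Qed.

HB.instance Definition _ n := GRing.isLinear.Build C (F n) fsum _ (@single n)
  (@single_linear n).

Lemma fsum_val_sum x N n :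
  val (\sum_(m < N) single (val x m)) n = if (n < N)%N then val x n else 0.
Proof.
have morph (I : Type) (s : seq I) (G : I -> fsum) :
    val (\sum_(i <- s) G i) n = \sum_(i <- s) val (G i) n.
  by elim: s => [|i s IH]; rewrite ?big_nil // !big_cons -IH.
rewrite morph; case: ltnP => nN.
  rewrite (bigD1 (Ordinal nN)) //= single_in big1 ?addr0 // => m nm.
  by rewrite single_out.
by rewrite big1 // => m _; rewrite single_out // ltn_eqF // (leq_trans (ltn_ord m)).
Qed.

Lemma fsumE x N : (supp x <= N)%N -> x = \sum_(n < N) single (val x n).
Proof.
move=> xN; apply/val_inj/functional_extensionality_dep => n.
rewrite fsum_val_sum; case: ltnP => // Nn.
by rewrite suppP // (leq_trans xN).
Qed.

Section Lift.
Variables (L : lmodType C) (f : forall n, {linear F n -> L}).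

Definition fsum_map x : L := \sum_(n < supp x) f n (val x n).

Lemma fsum_mapE x N : vanishes_from (val x) N -> fsum_map x = \sum_(n < N) f n (val x n).
Proof.
move=> xN; have ext M K : vanishes_from (val x) M -> (M <= K)%N ->
    \sum_(n < K) f n (val x n) = \sum_(n < M) f n (val x n).
  move=> xM /subnK <-; rewrite addnC; elim: (K - M)%N => [|k IH]; first by rewrite addn0.
  by rewrite addnS big_ord_recr /= IH xM ?leq_addr // linear0 addr0.
have [h|/ltnW h] := leqP N (supp x); first exact: ext xN h.
by rewrite (ext _ _ (@suppP x) h).
Qed.

Fact fsum_map_linear : linear fsum_map.
Proof.
move=> a x y; set N := (supp x + supp y)%N.
have xN : vanishes_from (val x) N by move=> n Nn; apply: suppP; exact: leq_trans (leq_addr _ _) Nn.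
have yN : vanishes_from (val y) N by move=> n Nn; apply: suppP; exact: leq_trans (leq_addl _ _) Nn.
have aN : vanishes_from (val (a *: x + y)) N.
  by move=> n Nn; rewrite -[LHS]/(a *: val x n + val y n) xN // yN // scaler0 addr0.
rewrite (fsum_mapE aN) (fsum_mapE xN) (fsum_mapE yN) scaler_sumr -big_split /=.
by apply: eq_bigr => n _; rewrite -linearP.
Qed.

HB.instance Definition _ := GRing.isLinear.Build C fsum L _ fsum_map fsum_map_linear.

Lemma fsum_map_single n u : fsum_map (single u) = f n u.
Proof.
rewrite (@fsum_mapE (single u) n.+1); last exact: single_vanishes.
rewrite big_ord_recr /= single_in big1 ?add0r // => m _.
by rewrite single_out ?linear0 // gtn_eqF.
Qed.

End Lift.

Lemma vanishes_supp2 x y : vanishes_from (val x) (supp x + supp y) /\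
  vanishes_from (val y) (supp x + supp y).
Proof.
by split=> n Nn; apply: suppP; apply: leq_trans Nn; rewrite ?leq_addr ?leq_addl.
Qed.

End DependentSequences.

(** * Hilbert sums and direct limits *)

Section Sums.
Context {R : realType}.
Local Notation C := R[i].

Lemma pythagoras_sum (H : hilbertType R) (v : nat -> H) N :
  (forall m n, m != n -> hdot (v m) (v n) = 0) ->
  `|\sum_(n < N) v n| ^+ 2 = \sum_(n < N) `|v n| ^+ 2.
Proof.
move=> vo; elim: N => [|N IH]; first by rewrite !big_ord0 normr0 expr0n.
have orth n : (n <= N)%N -> hdot (\sum_(k < n) v k) (v N) = 0.
  elim: n {IH} => [|n IH] nN; first by rewrite big_ord0 hdot0l.
  by rewrite big_ord_recr /= hdotDl IH ?(ltnW nN) // vo ?add0r // ltn_eqF.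
by rewrite !big_ord_recr /= hnormD_orth ?IH ?orth.
Qed.

Section HilbertSum.
Variable F : nat -> hilbertType R.

Let E := fsum F.

Let dot (x y : E) : C := \sum_(n < supp x + supp y) hdot (val x n) (val y n).

Let dotE (x y : E) N : vanishes_from (val x) N \/ vanishes_from (val y) N ->
  dot x y = \sum_(n < N) hdot (val x n) (val y n).
Proof.
move=> xyN; have ext M K : vanishes_from (val x) M \/ vanishes_from (val y) M ->
    (M <= K)%N ->
    \sum_(n < K) hdot (val x n) (val y n) = \sum_(n < M) hdot (val x n) (val y n).
  move=> xyM /subnK <-; rewrite addnC; elim: (K - M)%N => [|k IH]; first by rewrite addn0.
  rewrite addnS big_ord_recr /= IH.
  by case: xyM => -> //; rewrite ?leq_addr // ?hdot0l ?hdot0r addr0.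
have s2 := (vanishes_supp2 x y).1; rewrite /dot.
have [h|/ltnW h] := leqP N (supp x + supp y); first exact: ext xyN h.
by rewrite (ext _ _ (or_introl s2) h).
Qed.

Let dot_linear a x y z : dot (a *: x + y) z = a * dot x z + dot y z.
Proof.
have zN : vanishes_from (val z) (supp z) by exact: suppP.
rewrite !(dotE (or_intror zN)) mulr_sumr -big_split /=.
by apply: eq_bigr => n _; rewrite -hdotZl -hdotDl.
Qed.

Let dot_conj x y : dot y x = (dot x y)^*.
Proof.
have zN : vanishes_from (val x) (supp x) by exact: suppP.
rewrite (dotE (or_intror zN)) (dotE (or_introl zN)) rmorph_sum.
by apply: eq_bigr => n _; exact: hdotC.
Qed.

Let dot_ge0 x : 0 <= dot x x.
Proof. by apply: sumr_ge0 => n _; exact: hdot_ge0. Qed.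

(** The last two clauses are the universal property with respect to families of
   contractions with orthogonal ranges; they replace every later appeal to the
   construction. *)
Definition is_hilbert_sum (K : hilbertType R) (i : forall n, {linear F n -> K}) :=
  [/\ forall n, isometric (i n),
      forall m n x y, m != n -> hdot (i m x) (i n y) = 0,
      forall (L : hilbertType R) (f : forall n, {linear F n -> L}),
        (forall n, nonexpansive (f n)) ->
        (forall m n x y, m != n -> hdot (f m x) (f n y) = 0) ->
        exists G : {linear K -> L}, [/\ forall n x, G (i n x) = f n x,
          nonexpansive G & (forall n, isometric (f n)) -> isometric G] &
      forall (L : hilbertType R) (f g : {linear K -> L}), nonexpansive f -> nonexpansive g ->
        (forall n x, f (i n x) = g (i n x)) -> forall x, f x = g x].

Theorem hilbert_sum : exists K i, @is_hilbert_sum K i.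
Proof.
have [K [i [iE id]]] := hilbert_completion (Sform dot_linear dot_conj dot_ge0).
have inE (x : E) : `|i x| ^+ 2 = \sum_(n < supp x) `|val x n| ^+ 2.
  rewrite -hdot_norm iE /= (dotE (or_introl (@suppP _ _ x))).
  by apply: eq_bigr => n _; rewrite hdot_norm.
have il n : linear (fun u : F n => i (single u)).
  by move=> a u v; rewrite single_linear linearP.
exists K, (fun n => mklinear (il n)); split=> [n x|m n x y mn|L f fc fo|L f g fc gc fg].
- apply/eqP; rewrite /= -(eqrXn2 (n := 2)) // -!hdot_norm iE /=; apply/eqP.
  rewrite (dotE (or_introl (@single_vanishes _ _ _ _))) big_ord_recr /= single_in.
  by rewrite big1 ?add0r // => m _; rewrite single_out ?hdot0l // gtn_eqF.
- rewrite /= iE /= (dotE (or_introl (@single_vanishes _ _ _ _))) big1 // => k _.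
  have [e|mk] := eqVneq m k; last by rewrite single_out ?hdot0l.
  by rewrite [in X in hdot _ X]single_out ?hdot0r // -e eq_sym.
- have fE (x : E) : `|fsum_map f x| ^+ 2 = \sum_(n < supp x) `|f n (val x n)| ^+ 2.
    by apply: (@pythagoras_sum L (fun n => f n (val x n))) => m n mn; exact: fo.
  have fi (x : E) : `|fsum_map f x| <= `|i x|.
    rewrite -ler_sqr ?nnegrE // fE inE.
    by apply: ler_sum => n _; rewrite ler_sqr ?nnegrE ?fc.
  have [G [Gi Gc Giso]] := dense_extend id fi; exists G; split=> // [n x|f_iso].
    by rewrite /= Gi /= fsum_map_single.
  apply: Giso => x; apply/eqP; rewrite -(eqrXn2 (n := 2)) //; apply/eqP.
  by rewrite fE inE; apply: eq_bigr => n _; rewrite f_iso.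
- apply: (dense_eq id ler01 ler01) => x; rewrite ?mul1r //.
  by rewrite (fsumE (leqnn (supp x))) !linear_sum; apply: eq_bigr => n _; exact: fg.
Qed.

End HilbertSum.

Section DirectLimit.
Variables (K : hilbertType R) (j : {linear K -> K}).
Hypothesis j_isom : isometric j.

Let E := fsum (fun _ => K : lmodType C).

Let level (N : nat) (x : E) : K := \sum_(n < N) iter (N - n) j (val x n).

Let iter_linear n : linear (iter n j).
Proof. by elim: n => [|n IH] a x y //=; rewrite IH linearP. Qed.

Let level_linear N : linear (level N).
Proof.
move=> a x y; rewrite /level scaler_sumr -big_split /=.
by apply: eq_bigr => n _; rewrite -iter_linear.
Qed.

Let levelS (x : E) N : vanishes_from (val x) N -> level N.+1 x = j (level N x).
Proof.
move=> xN; rewrite /level big_ord_recr /= (xN N) // subSnn /= linear0 addr0 linear_sum.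
by apply: eq_bigr => n _; rewrite subSn ?(ltnW (ltn_ord n)).
Qed.

Let dot (x y : E) : C := hdot (level (supp x + supp y) x) (level (supp x + supp y) y).

Let dotE (x y : E) N : vanishes_from (val x) N -> vanishes_from (val y) N ->
  dot x y = hdot (level N x) (level N y).
Proof.
move=> xN yN; have ext M P : vanishes_from (val x) M -> vanishes_from (val y) M ->
    (M <= P)%N -> hdot (level P x) (level P y) = hdot (level M x) (level M y).
  move=> xM yM /subnK <-; rewrite addnC; elim: (P - M)%N => [|k IH]; first by rewrite addn0.
  have van (z : E) : vanishes_from (val z) M -> vanishes_from (val z) (M + k).
    by move=> zM n Mn; apply: zM; exact: leq_trans (leq_addr _ _) Mn.
  by rewrite addnS !levelS ?isometric_hdot //; exact: van.
have [s1 s2] := vanishes_supp2 x y; rewrite /dot.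
have [h|/ltnW h] := leqP N (supp x + supp y); first exact: ext.
by rewrite (ext _ _ s1 s2 h).
Qed.

Let van (x : E) N : (supp x <= N)%N -> vanishes_from (val x) N.
Proof. by move=> xN n Nn; apply: suppP; exact: leq_trans Nn. Qed.

Let dot_linear a x y z : dot (a *: x + y) z = a * dot x z + dot y z.
Proof.
set N := (supp (a *: x + y)%R + (supp x + (supp y + supp z)))%N.
have h w : w \in [:: a *: x + y; x; y; z] -> vanishes_from (val w) N.
  rewrite !inE => /or4P[] /eqP->; apply: van; rewrite /N; lia.
rewrite !(@dotE _ _ N); try by apply: h; rewrite !inE eqxx ?orbT.
by have -> := level_linear N a x y; rewrite hdotDl hdotZl.
Qed.

Let dot_conj x y : dot y x = (dot x y)^*.
Proof. by have [s1 s2] := vanishes_supp2 x y; rewrite (dotE s2 s1) -hdotC. Qed.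

Let dot_ge0 x : 0 <= dot x x.
Proof. exact: hdot_ge0. Qed.

(** The colimit of K -> K -> K -> ... along j, with the n-th copy of K embedded
   by i n. *)
Definition is_direct_limit (L : hilbertType R) (i : nat -> {linear K -> L}) :=
  [/\ forall n, isometric (i n),
      forall n x, i n.+1 (j x) = i n x,
      forall (M : hilbertType R) (f : nat -> {linear K -> M}),
        (forall n, nonexpansive (f n)) -> (forall n x, f n.+1 (j x) = f n x) ->
        exists G : {linear L -> M}, [/\ forall n x, G (i n x) = f n x,
          nonexpansive G & (forall n, isometric (f n)) -> isometric G] &
      forall (M : hilbertType R) (f g : {linear L -> M}), nonexpansive f -> nonexpansive g ->
        (forall n x, f (i n x) = g (i n x)) -> forall x, f x = g x].

(** A finitely supported sequence stands for the sum of its terms, all pushed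
   along j to a common level; since j is isometric, the inner product computed
   there does not depend on the level. *)
Theorem direct_limit : exists L i, @is_direct_limit L i.
Proof.
have [L [i [iE id]]] := hilbert_completion (Sform dot_linear dot_conj dot_ge0).
have inE N (x : E) : vanishes_from (val x) N -> `|i x| = `|level N x|.
  move=> xN; apply/eqP; rewrite -(eqrXn2 (n := 2)) // -!hdot_norm iE /=; apply/eqP.
  exact: dotE.
pose inj n (u : K) : E := @single _ (fun=> K : lmodType C) n u.
have injE n (u : K) m : val (inj n u) m = if m == n then u else 0.
  have [->|mn] := eqVneq m n; first exact: single_in.
  by apply: single_out; rewrite eq_sym.
have level_single n N u : (n < N)%N -> level N (inj n u) = iter (N - n) j u.
  move=> nN; have i0 k : iter k j 0 = 0 by elim: k => //= k ->; rewrite linear0.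
  transitivity (\sum_(m < N) iter (N - m) j (if m == n :> nat then u else 0)).
    by apply: eq_bigr => m _; congr (iter _ j _); exact: injE.
  rewrite (bigD1 (Ordinal nN)) //= eqxx big1 ?addr0 // => m nm.
  by rewrite -[m == n :> nat]/(m == Ordinal nN) (negPf nm) i0.
have il n : linear (fun u : K => i (@single _ (fun=> K : lmodType C) n u)).
  by move=> a u v; rewrite single_linear linearP.
exists L, (fun n => mklinear (il n)); split=> [n x|n x|M f fc fj|M f g fc gc fg].
- rewrite /= (inE n.+1); last exact: single_vanishes.
  by rewrite (level_single n) // subSnn /= j_isom.
- apply/eqP; rewrite -subr_eq0 -normr_eq0 /= -linearB.
  rewrite (inE n.+2).
    have lB := level_linear n.+2 (-1) (inj n x) (inj n.+1 (j x)).
    rewrite addrC -scaleN1r lB !level_single // scaleN1r.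
    by rewrite subSnn subSn ?leqnSn // subSnn /= addNr normr0.
  move=> m nm; rewrite -[LHS]/(val (inj _ _) m - val (inj _ _) m) !injE.
  by rewrite !gtn_eqF ?subrr //; exact: ltnW.
- have fE N (x : E) : vanishes_from (val x) N -> fsum_map f x = f N (level N x).
    move=> xN; rewrite (fsum_mapE f xN) /level linear_sum; apply: eq_bigr => n _.
    have fit k m y : f (k + m)%N (iter k j y) = f m y.
      by elim: k => [|k IH] //; rewrite addSn iterS fj.
    by have := fit (N - n)%N n (val x n); rewrite subnK ?(ltnW (ltn_ord n)).
  have fi (x : E) : `|fsum_map f x| <= `|i x|.
    by rewrite (fE _ _ (@suppP _ _ x)) (inE _ _ (@suppP _ _ x)); exact: fc.
  have [G [Gi Gc Giso]] := dense_extend id fi; exists G; split=> // [n x|f_iso].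
    exact: etrans (Gi _) (@fsum_map_single _ (fun=> K : lmodType C) _ f n x).
  apply: Giso => x; rewrite (inE _ _ (@suppP _ _ x)) -(f_iso (supp x)).
  exact: (congr1 Num.norm (fE _ _ (@suppP _ _ x))).
- apply: (dense_eq id ler01 ler01) => x; rewrite ?mul1r //.
  by rewrite (fsumE (leqnn (supp x))) !linear_sum; apply: eq_bigr => n _; exact: fg.
Qed.

End DirectLimit.
End Sums.

(** * Unitaries, defect spaces and isometric coextensions *)

Section Isometries.
Context {R : realType}.
Local Notation C := R[i].
Implicit Types H K L : hilbertType R.

Definition bijective_isometry H (U : {linear H -> H}) :=
  isometric U /\ exists V : {linear H -> H}, cancel U V /\ cancel V U.

Lemma isometric_inj H K (f : {linear H -> K}) : isometric f -> injective f.
Proof.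
move=> fi x y xy; apply/eqP; rewrite -subr_eq0 -normr_eq0 -fi linearB xy subrr.
by rewrite normr0.
Qed.

Lemma onto_isometry_bijective H (U : {linear H -> H}) :
  isometric U -> (forall y, exists x, U x = y) -> bijective_isometry U.
Proof.
move=> Ui /choice [V VK]; split=> //.
have Vl : linear V.
  by move=> a x y; apply: (isometric_inj Ui); rewrite linearP !VK.
by exists (mklinear Vl); split=> x /=; [apply: (isometric_inj Ui); rewrite VK | rewrite VK].
Qed.

Lemma bijective_isometry_inv H (U : {linear H -> H}) : bijective_isometry U ->
  exists V : {linear H -> H}, [/\ cancel U V, cancel V U & bijective_isometry V].
Proof.
move=> [Ui [V [UK VK]]]; exists V; split=> //; split; last by exists U.
by move=> x; rewrite -Ui VK.
Qed.

Lemma bijective_isometry_unitary H (U : {linear H -> H}) : bijective_isometry U -> unitary U.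
Proof.
move=> [Ui [V [UK VK]]]; exists V => // x y.
by rewrite -[y in LHS]VK isometric_hdot.
Qed.

(** D is the defect operator (1 - A^* A)^(1/2) up to a unitary: completing the
   form <x, y> - <A x, A y> avoids taking square roots of operators. *)
Lemma defect_space H K (A : {linear H -> K}) : nonexpansive A ->
  exists (L : hilbertType R) (D : {linear H -> L}),
    (forall x, `|A x| ^+ 2 + `|D x| ^+ 2 = `|x| ^+ 2) /\ dense_map D.
Proof.
move=> Ac; pose q x y : C := hdot x y - hdot (A x) (A y).
have ql a x y z : q (a *: x + y) z = a * q x z + q y z.
  by rewrite /q linearP hdot_linear hdot_linear; ring.
have qc x y : q y x = (q x y)^* by rewrite /q rmorphB /= -!hdotC.
have q0 x : 0 <= q x x by rewrite /q !hdot_norm subr_ge0 ler_sqr ?nnegrE.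
have [L [D [DE Dd]]] := hilbert_completion (Sform ql qc q0).
exists L, D; split=> // x; rewrite -(hdot_norm (D x)) DE /= /q !hdot_norm.
by rewrite addrC subrK.
Qed.

Definition constant_tail (H L : hilbertType R) : nat -> hilbertType R :=
  fun n => if n is 0 then H else L.

(** V is isometric because the defect D h makes up for the norm lost by A h, and
   because moving the copies of L by one keeps all the images orthogonal. *)
Lemma isometric_coextension H L (A : {linear H -> H}) (D : {linear H -> L}) :
  (forall x, `|A x| ^+ 2 + `|D x| ^+ 2 = `|x| ^+ 2) ->
  exists (K : hilbertType R) (i : forall n, {linear constant_tail H L n -> K})
    (V : {linear K -> K}) (p : {linear K -> H}),
    [/\ is_hilbert_sum i, isometric V /\ nonexpansive p,
        (forall h, V (i 0%N h) = i 0%N (A h) + i 1%N (D h)) /\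
        (forall n (d : L), V (i n.+1 d) = i n.+2 d),
        forall h, p (i 0%N h) = h & forall x, p (V x) = A (p x)].
Proof.
move=> AD; have [K [i iS]] := hilbert_sum (constant_tail H L).
have [iI io iE iU] := iS; exists K, i.
have f0l : linear (fun h : H => i 0%N (A h) + i 1%N (D h)).
  move=> a x y; rewrite !linearP /= scalerDr addrACA //.
pose f n : {linear constant_tail H L n -> K} :=
  match n return {linear constant_tail H L n -> K} with 0 => mklinear f0l | n.+1 => i n.+2 end.
have o01 (h : H) (d : L) : hdot (i 0%N h) (i 1%N d) = 0.
  exact: (io 0%N 1%N h d isT).
have fI n : isometric (f n).
  case: n => [|n] x; last exact: (iI n.+2).
  apply/eqP; rewrite /= -(eqrXn2 (n := 2)) //; apply/eqP.
  by rewrite hnormD_orth; [rewrite (iI 0%N) (iI 1%N) AD | exact: o01].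
have [m n x y mn|V [VE Vc VI]] := iE K f (fun n => isometric_nonexpansive (fI n)).
  case: m x mn => [|m] x; case: n y => [|n] y //= mn; last exact: (io m.+2 n.+2 _ _ mn).
    by rewrite hdotDl (io 0%N n.+2 _ _ isT) (io 1%N n.+2 _ _ isT) addr0.
  by rewrite hdotDr (io m.+2 0%N _ _ isT) (io m.+2 1%N _ _ isT) addr0.
have z0l n : linear (fun _ : constant_tail H L n => 0 : H).
  by move=> a x y; rewrite scaler0 addr0.
pose g n : {linear constant_tail H L n -> H} :=
  match n return {linear constant_tail H L n -> H} with 0 => idfun | n.+1 => mklinear (z0l n.+1) end.
have gc n : nonexpansive (g n).
  by case: n => [|n] x //=; rewrite normr0.
have [m n x y mn|p [pE pc _]] := iE H g gc.
  by case: m x mn => [|m] x; case: n y => [|n] y //= mn; rewrite ?hdot0l ?hdot0r.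
have Ac : nonexpansive A.
  by move=> x; rewrite -ler_sqr ?nnegrE // -(AD x) lerDl exprn_ge0.
have VI' := VI fI.
have Vp x : p (V x) = A (p x).
  apply: (iU H (p \o V) (A \o p)); try exact: nonexpansive_comp.
  case=> [|n] h /=; first by rewrite (VE 0%N) (pE 0%N) linearD (pE 0%N) (pE 1%N) addr0.
  by rewrite (VE n.+1) (pE n.+1) (pE n.+2) linear0.
exists V, p; split; [by []|by split| |exact: (pE 0%N)|exact: Vp].
by split=> [h|n d]; [exact: (VE 0%N) | exact: (VE n.+1)].
Qed.

End Isometries.

(** * The inequality of von Neumann *)

Section VonNeumann.
Context {R : realType}.
Local Notation C := R[i].
Implicit Types H K L : hilbertType R.

Lemma prim_root_exists M : (0 < M)%N -> exists w : C, M.-primitive_root w.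
Proof.
move=> M0; pose p : {poly C} := 'X^M - 1; have [r Dp] := closed_field_poly_normal p.
rewrite (monicP _) ?monicXnsubC // scale1r in Dp.
have rn1 : all M.-unity_root r.
  by apply/allP=> z; rewrite -root_prod_XsubC -Dp.
have sz_r : (M < (size r).+1)%N.
  by rewrite -(size_prod_XsubC r id) -Dp size_XnsubC.
have [|z _ zM] := hasP (cyclic.has_prim_root M0 rn1 _ sz_r); last by exists z.
by rewrite -separable.separable_prod_XsubC -Dp cyclotomic.separable_Xn_sub_1 // pnatr_eq0 -lt0n.
Qed.

Lemma norm_prim_root M (w : C) : M.-primitive_root w -> `|w| = 1.
Proof.
move=> wM; have M0 := prim_order_gt0 wM; apply/eqP.
by rewrite -(@pexpr_eq1 _ _ M) // -normrX prim_expr_order // normr1.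
Qed.

(** Orthogonality of the characters of the cyclic group of order M. *)
Lemma parseval M (w : C) H (v : nat -> H) : M.-primitive_root w ->
  \sum_(k < M) `|\sum_(i < M) w ^+ (k * i) *: v i| ^+ 2 =
  M%:R * \sum_(i < M) `|v i| ^+ 2.
Proof.
move=> wM; have w1 := norm_prim_root wM.
have w0 : w != 0 by rewrite -normr_eq0 w1 oner_eq0.
have wc : w^* = w^-1 by rewrite invC_norm w1 expr1n invr1 mul1r.
have dl (I : Type) (s : seq I) (G : I -> H) y : hdot (\sum_(i <- s) G i) y = \sum_(i <- s) hdot (G i) y.
  by elim: s => [|i s IH]; rewrite ?big_nil ?hdot0l // !big_cons hdotDl IH.
have dr (I : Type) (s : seq I) (G : I -> H) y : hdot y (\sum_(i <- s) G i) = \sum_(i <- s) hdot y (G i).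
  by elim: s => [|i s IH]; rewrite ?big_nil ?hdot0r // !big_cons hdotDr IH.
transitivity (\sum_(i < M) \sum_(j < M)
    (\sum_(k < M) (w ^+ i / w ^+ j) ^+ k) * hdot (v i) (v j)).
  transitivity (\sum_(k < M) \sum_(i < M) \sum_(j < M)
      (w ^+ i / w ^+ j) ^+ k * hdot (v i) (v j)).
    apply: eq_bigr => k _; rewrite -hdot_norm dl; apply: eq_bigr => i _.
    rewrite dr; apply: eq_bigr => j _; rewrite hdotZl hdotZr mulrA; congr (_ * _).
    by rewrite rmorphXn /= wc exprMn exprVn -!exprM exprVn -exprM ![(k * _)%N]mulnC.
  rewrite exchange_big; apply: eq_bigr => i _; rewrite exchange_big.
  by apply: eq_bigr => j _; rewrite mulr_suml.
rewrite mulr_sumr; apply: eq_bigr => i _.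
rewrite (bigD1 i) //= divff ?expf_neq0 // [X in _ + X]big1 => [|j ji].
  rewrite addr0 hdot_norm; congr (_ * _).
  by under eq_bigr do rewrite expr1n; rewrite sumr_const card_ord.
set z := w ^+ i / w ^+ j.
have z1 : z != 1.
  apply: contra ji => /eqP z1; apply/eqP/val_inj/eqP; rewrite /= eq_sym.
  have /eqP : w ^+ i = w ^+ j by rewrite -[RHS]mul1r -z1 divfK // expf_neq0.
  by rewrite (eq_prim_root_expr wM) !modn_small.
have zM : z ^+ M = 1.
  rewrite exprMn exprVn -!exprM ![(_ * M)%N]mulnC !exprM !(prim_expr_order wM).
  by rewrite !expr1n divr1.
have : (z - 1) * \sum_(k < M) z ^+ k = 0 by rewrite -subrX1 zM subrr.
by move/eqP; rewrite mulf_eq0 subr_eq0 (negPf z1) /= => /eqP ->; rewrite mul0r.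
Qed.

Lemma iter_lin H (A : {linear H -> H}) n : linear (iter n A).
Proof. by elim: n => [|n IH] a x y //=; rewrite IH linearP. Qed.

Lemma iter_isometric H (A : H -> H) n : isometric A -> isometric (iter n A).
Proof. by move=> Ai; elim: n => [|n IH] x //=; rewrite Ai IH. Qed.

(** With F z = sum over i <= N of z^i V^(N-i) x, the product p(z) F(z) has
   V^(N-m) (p(V) x) as its m-th coefficient for deg p <= m <= N.  Comparing the
   mean squares of F and p F over roots of unity and letting N grow bounds
   p(V) x. *)
Lemma von_neumann_isometry H (V : {linear H -> H}) (p : {poly C}) (d : C) :
  isometric V -> (forall z, closed_disk z -> `|p.[z]| <= d) ->
  forall x, `|poly_op V p x| <= d * `|x|.
Proof.
move=> Vi pd x; set n := size p.
have d0 : 0 <= d by apply: le_trans (pd 0 _); rewrite /closed_disk /= ?normr0.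
rewrite -ler_sqr ?nnegrE ?mulr_ge0 //.
apply: (@le_rate _ _ _ (n%:R * (d * `|x|) ^+ 2)).
  by rewrite mulr_ge0 ?exprn_ge0 // mulr_ge0.
move=> L; set N := (n + L)%N; set M := (N.+1 + n)%N.
have M0 : (0 < M)%N by rewrite /M addSn.
have [w wM] := prim_root_exists M0.
pose g i : H := if (i <= N)%N then iter (N - i) V x else 0.
pose v m : H := \sum_(j < n) p`_j *: (if (j <= m)%N then g (m - j)%N else 0).
have gsum k P : (N < P)%N -> \sum_(i < P) w ^+ (k * i) *: g i =
    \sum_(i < N.+1) w ^+ (k * i) *: g i.
  move=> /subnK <-; rewrite addnC; elim: (P - N.+1)%N => [|q IH]; first by rewrite addn0.
  by rewrite addnS big_ord_recr /= IH /g leqNgt addSn ltnS leq_addr /= scaler0 addr0.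
have shift k j : (j < n)%N -> \sum_(m < M) w ^+ (k * m) *: (if (j <= m)%N then g (m - j)%N else 0)
    = w ^+ (k * j) *: \sum_(i < N.+1) w ^+ (k * i) *: g i.
  move=> jn; have MjP : M = (j + (M - j))%N by rewrite subnKC // /M; lia.
  rewrite [in LHS]MjP big_split_ord /= big1 => [|i _]; last first.
    by rewrite leqNgt ltn_ord scaler0.
  rewrite add0r -(@gsum k (M - j)%N); last by rewrite /M; lia.
  rewrite scaler_sumr; apply: eq_bigr => i _.
  by rewrite leq_addr addKn scalerA -exprD mulnDr.
have vsum k : \sum_(m < M) w ^+ (k * m) *: v m =
    p.[w ^+ k] *: \sum_(i < N.+1) w ^+ (k * i) *: g i.
  rewrite horner_coef scaler_suml.
  transitivity (\sum_(m < M) \sum_(j < n) p`_j *: (w ^+ (k * m) *: (if (j <= m)%N then g (m - j)%N else 0))).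
    apply: eq_bigr => m _; rewrite scaler_sumr; apply: eq_bigr => j _.
    by rewrite !scalerA mulrC.
  rewrite exchange_big; apply: eq_bigr => j _.
  by rewrite -scaler_sumr shift // scalerA -exprM.
have gi i : (i <= N)%N -> `|g i| = `|x| by move=> iN; rewrite /g iN iter_isometric.
have vE m : (n <= m <= N)%N -> `|v m| = `|poly_op V p x|.
  move=> /andP[nm mN]; rewrite -[RHS](iter_isometric (N - m) Vi); congr `|_|.
  have ll := iter_lin V (N - m); rewrite /poly_op -[iter _ _]/(mklinear ll : _ -> _) linear_sum.
  apply: eq_bigr => j _; have jm : (j <= m)%N by apply: leq_trans nm; exact: ltnW.
  rewrite linearZ /= jm /g ifT; last by lia.
  have e : (N - (m - j) = (N - m) + j)%N by move: jm mN; clear; lia.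
  by rewrite e iterD.
have key : L.+1%:R * `|poly_op V p x| ^+ 2 <= d ^+ 2 * (N.+1%:R * `|x| ^+ 2).
  apply: le_trans (_ : \sum_(m < M) `|v m| ^+ 2 <= _).
    have ->: M = (n + (L.+1 + n))%N by rewrite /M /N; lia.
    rewrite big_split_ord big_split_ord /= addrCA.
    rewrite [X in _ <= X + _](eq_bigr (fun=> `|poly_op V p x| ^+ 2)); last first.
      by move=> i _; rewrite vE // /N leq_addr /= leq_add2l -ltnS.
    rewrite sumr_const card_ord mulr_natl lerDl.
    by rewrite addr_ge0 ?sumr_ge0 // => i _; rewrite exprn_ge0.
  have MR : 0 < M%:R :> C by rewrite ltr0n.
  rewrite -(ler_pM2l MR) -(parseval _ wM).
  apply: le_trans (_ : \sum_(k < M) d ^+ 2 * `|\sum_(i < M) w ^+ (k * i) *: g i| ^+ 2 <= _).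
    apply: ler_sum => k _; rewrite vsum -(@gsum k M) ?/M ?leq_addr // hnormZ exprMn.
    rewrite ler_wpM2r ?exprn_ge0 // ler_sqr ?nnegrE // pd // /closed_disk /=.
    by rewrite normrX (norm_prim_root wM) expr1n.
  rewrite -mulr_sumr (parseval _ wM) mulrCA; apply: eqle; congr (_ * (_ * _)).
  rewrite /M big_split_ord /= [X in _ + X]big1 => [|i _]; last first.
    by rewrite /g leqNgt addSn ltnS leq_addr normr0 expr0n.
  rewrite addr0 (eq_bigr (fun=> `|x| ^+ 2)); first by rewrite sumr_const card_ord mulr_natl.
  by move=> i _; rewrite gi // -ltnS.
rewrite -(ler_pM2l (ltr0Sn C L)); apply: le_trans key _.
rewrite /rate !exprMn mulrDr [X in _ + X]mulrCA divff ?pnatr_eq0 // mulr1.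
by apply: eqle; rewrite /N -addnS natrD; ring.
Qed.

(** p(A) is the compression of p(V), for V an isometric coextension of A. *)
Theorem von_neumann H (A : {linear H -> H}) (p : {poly C}) (d : C) :
  nonexpansive A -> (forall z, closed_disk z -> `|p.[z]| <= d) ->
  forall x, `|poly_op A p x| <= d * `|x|.
Proof.
move=> Ac pd x; have [L [D [AD _]]] := defect_space Ac.
have [K [i [V [q [[iI _ _ _] [Vi qc] _ q0 qV]]]]] := isometric_coextension AD.
have -> : poly_op A p x = q (poly_op V p (i 0%N x)).
  rewrite linear_sum; apply: eq_bigr => n _; rewrite linearZ; congr (_ *: _).
  by elim: (n : nat) => [|k IH] /=; rewrite ?q0 // qV IH.
apply: le_trans (qc _) _; apply: le_trans (von_neumann_isometry Vi pd _) _.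
by rewrite (iI 0%N).
Qed.

End VonNeumann.

(** * The functional calculus *)

Section Calculus.
Context {R : realType}.
Local Notation C := R[i].
Local Notation disk := (@closed_disk R).
Implicit Types (H K L : hilbertType R) (f g : C -> C) (p q : {poly C}).

Lemma poly_opE H (A : {linear H -> H}) p n x : (size p <= n)%N ->
  poly_op A p x = \sum_(i < n) p`_i *: iter i A x.
Proof.
move=> /subnK <-; rewrite addnC; elim: (n - size p)%N => [|k IH]; first by rewrite addn0.
by rewrite addnS big_ord_recr /= -IH nth_default ?leq_addr // scale0r addr0.
Qed.

Lemma poly_op_linear_poly H (A : {linear H -> H}) a p q x :
  poly_op A (a *: p + q) x = a *: poly_op A p x + poly_op A q x.
Proof.
set n := maxn (size p) (size q).
rewrite (@poly_opE _ _ p n) ?leq_maxl // (@poly_opE _ _ q n) ?leq_maxr //.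
rewrite (@poly_opE _ _ _ n); last first.
  apply: leq_trans (size_polyD _ _) _; rewrite geq_max leq_maxr andbT.
  exact: leq_trans (size_scale_leq _ _) (leq_maxl _ _).
rewrite scaler_sumr -big_split /=; apply: eq_bigr => i _.
by rewrite coefD coefZ scalerA -scalerDl.
Qed.

Lemma poly_opB H (A : {linear H -> H}) p q x :
  poly_op A (p - q) x = poly_op A p x - poly_op A q x.
Proof. by rewrite addrC -scaleN1r poly_op_linear_poly scaleN1r addrC. Qed.

Lemma poly_op_linear H (A : {linear H -> H}) p : linear (poly_op A p).
Proof.
move=> a x y; rewrite /poly_op scaler_sumr -big_split /=; apply: eq_bigr => i _.
by rewrite iter_lin scalerDr !scalerA mulrC.
Qed.

Lemma poly_opC H (A : {linear H -> H}) c x : poly_op A c%:P x = c *: x.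
Proof. by rewrite (@poly_opE _ _ _ 1) ?size_polyC_leq1 // big_ord1 coefC. Qed.

Lemma poly_opMX H (A : {linear H -> H}) p x : poly_op A (p * 'X) x = poly_op A p (A x).
Proof.
have [->|p0] := eqVneq p 0; first by rewrite mul0r /poly_op size_poly0 !big_ord0.
rewrite (@poly_opE _ _ _ (size p).+1) ?size_mulX // big_ord_recl coefMX scale0r add0r.
by apply: eq_bigr => i _; rewrite coefMX /= -iterSr.
Qed.

Lemma poly_op_intertwine H K (A : {linear H -> H}) (B : {linear K -> K})
    (X : {linear H -> K}) p : (forall x, X (A x) = B (X x)) ->
  forall x, X (poly_op A p x) = poly_op B p (X x).
Proof.
move=> XA x; rewrite linear_sum; apply: eq_bigr => i _; rewrite linearZ; congr (_ *: _).
by elim: (i : nat) => [|k IH] //=; rewrite XA IH.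
Qed.

Lemma poly_opM H (A : {linear H -> H}) p q x :
  poly_op A (p * q) x = poly_op A p (poly_op A q x).
Proof.
elim/poly_ind: p x => [|p c IH] x.
  by rewrite mul0r /poly_op size_poly0 !big_ord0.
rewrite mulrDl mulrAC -[_ + _](addrC) mul_polyC poly_op_linear_poly poly_opMX IH.
rewrite -[p * 'X + _]scale1r -[1 *: _]addr0 [in RHS]scale1r addr0 [in RHS]addrC.
have -> : c%:P + p * 'X = c *: 1 + p * 'X by rewrite -mul_polyC mulr1.
rewrite poly_op_linear_poly poly_opMX -[1]/(1%:P) poly_opC scale1r.
by rewrite -(@poly_op_intertwine _ _ A A A).
Qed.

Definition approximable f :=
  forall e : C, 0 < e -> exists p, forall z, disk z -> `|p.[z] - f z| <= e.

(** A quantitative form of the functional calculus: the error is no larger in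
   operator norm than uniformly on the disk. *)
Definition fcalc H (A : {linear H -> H}) f (B : H -> H) :=
  forall p (d : C), (forall z, disk z -> `|p.[z] - f z| <= d) ->
    forall x, `|poly_op A p x - B x| <= d * `|x|.

Lemma fcalc_ext H (A : {linear H -> H}) f g (B : H -> H) :
  (forall z, disk z -> f z = g z) -> fcalc A f B -> fcalc A g B.
Proof. by move=> fg h p d pd; apply: h => z zd; rewrite fg ?pd. Qed.

Lemma approximable_ext f g : (forall z, disk z -> f z = g z) ->
  approximable f -> approximable g.
Proof.
by move=> fg fa e e0; have [p hp] := fa e e0; exists p => z zd; rewrite -fg ?hp.
Qed.

Lemma fcalc_unique H (A : {linear H -> H}) f (B B' : H -> H) :
  approximable f -> fcalc A f B -> fcalc A f B' -> B =1 B'.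
Proof.
move=> fa hB hB' x; apply/eqP; rewrite -subr_eq0 -normr_le0.
apply: (@le_rate _ _ _ (`|x| *+ 2)); first by rewrite mulrn_wge0.
move=> n; have [p hp] := fa _ (rate_gt0 n); rewrite add0r -(subrKA (poly_op A p x)).
apply: le_trans (ler_normD _ _) _; rewrite mulrnAl mulr2n mulrC lerD ?hB' //.
by rewrite distrC hB.
Qed.

Lemma fcalc_exists H (A : {linear H -> H}) f : nonexpansive A -> approximable f ->
  exists B : {linear H -> H}, fcalc A f B.
Proof.
move=> Ac fa; have /choice [p hp] : forall n, exists p, forall z, disk z -> `|p.[z] - f z| <= rate n.
  by move=> n; exact/fa/rate_gt0.
have vn q r d e : (forall z, disk z -> `|q.[z] - f z| <= d) ->
    (forall z, disk z -> `|r.[z] - f z| <= e) ->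
    forall x, `|poly_op A q x - poly_op A r x| <= `|x| * (d + e).
  move=> hq hr x; rewrite -poly_opB mulrC; apply: von_neumann => // z zd.
  rewrite hornerD hornerN -(subrKA (f z)); apply: le_trans (ler_normD _ _) _.
  by rewrite lerD ?hq // distrC hr.
have /choice [B hB] : forall x, exists y, forall n, `|poly_op A (p n) x - y| <= `|x| * rate n.
  move=> x; apply: (@fast_complete R H (fun n => poly_op A (p n) x)) => // m n.
  exact: (vn _ _ _ _ (hp m) (hp n)).
have BA : fcalc A f B.
  move=> q d hq x; apply: (@le_rate _ _ _ (`|x| *+ 2)); first by rewrite mulrn_wge0.
  move=> n; rewrite -(subrKA (poly_op A (p n) x)); apply: le_trans (ler_normD _ _) _.
  apply: le_trans (lerD (vn _ _ _ _ hq (hp n) x) (hB x n)) _.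
  by apply: eqle; rewrite mulrDr mulrnAl mulr2n mulrC addrA.
have Bl : linear B.
  move=> a x y; apply/eqP; rewrite -subr_eq0 -normr_le0.
  apply: (@le_rate _ _ _ (`|a *: x + y| + (`|a| * `|x| + `|y|))).
    by rewrite !addr_ge0 ?mulr_ge0.
  move=> n; rewrite add0r -(subrKA (poly_op A (p n) (a *: x + y))) {2}poly_op_linear.
  apply: le_trans (ler_normD _ _) _; rewrite mulrDl lerD //; first by rewrite distrC.
  rewrite opprD addrACA -scalerBr; apply: le_trans (ler_normD _ _) _.
  by rewrite hnormZ mulrDl lerD // -mulrA ler_wpM2l.
by exists (mklinear Bl).
Qed.

Lemma disk_calculusE H (A : {linear H -> H}) (f : disk_algebra R) (B : H -> H) :
  approximable f -> fcalc A f B -> disk_calculus A f = B.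
Proof.
move=> fa hB; apply: get_unique.
  by move=> e e0; exists e => // p hp x; exact: hB.
move=> B' hB'; apply/funext => x; apply/eqP; rewrite -subr_eq0 -normr_le0.
apply: (@le_rate _ _ _ (`|x| *+ 2)); first by rewrite mulrn_wge0.
move=> n; have [d d0 hd] := hB' _ (rate_gt0 n).
have [m /(_ m (leqnn _)) hm] := rate_le_nat d0.
have [N /(_ N (leqnn _)) hN] : exists N, forall k, (N <= k)%N -> rate k <= rate n :> C.
  by apply: rate_le_nat; exact: rate_gt0.
have [p hp] := fa _ (rate_gt0 (maxn m n)).
have mono k : (k <= maxn m n)%N -> rate (maxn m n) <= rate k :> C.
  by move=> km; rewrite lef_pV2 ?posrE ?ltr0Sn // ler_nat ltnS.
rewrite add0r -(subrKA (poly_op A p x)).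
apply: le_trans (ler_normD _ _) _; rewrite mulrnAl mulr2n mulrC lerD //.
  rewrite distrC; apply: hd => z zd; apply: le_trans (hp z zd) _.
  by apply: le_trans hm; exact: mono (leq_maxl _ _).
apply: hB => z zd; apply: le_trans (hp z zd) _.
exact: mono (leq_maxr _ _).
Qed.

Lemma fcalc_bound H (A : {linear H -> H}) f B (M : C) : nonexpansive A ->
  approximable f -> fcalc A f B -> (forall z, disk z -> `|f z| <= M) ->
  forall x, `|B x| <= M * `|x|.
Proof.
move=> Ac fa hB fM x; apply: (@le_rate _ _ _ (`|x| *+ 2)); first by rewrite mulrn_wge0.
move=> n; have [p hp] := fa _ (rate_gt0 n).
rewrite -[X in `|X| <= _](subrK (poly_op A p x)); apply: le_trans (ler_normD _ _) _.
have h1 : `|poly_op A p x| <= (M + rate n) * `|x|.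
  apply: von_neumann => // z zd; rewrite -(subrK (f z) p.[z]) addrC.
  by apply: le_trans (ler_normD _ _) _; rewrite lerD ?fM ?hp.
have h2 := hB p _ hp x; rewrite distrC in h2.
apply: le_trans (lerD h2 h1) _.
by apply: eqle; rewrite mulrDl addrCA mulrnAl mulr2n (mulrC `|x|).
Qed.

Lemma fcalc_poly H (A : {linear H -> H}) p : nonexpansive A ->
  fcalc A (fun z => p.[z]) (poly_op A p).
Proof.
move=> Ac q d hq x; rewrite -poly_opB; apply: von_neumann => // z zd.
by rewrite hornerD hornerN hq.
Qed.

Lemma approximable_poly p : approximable (fun z => p.[z]).
Proof. by move=> e e0; exists p => z _; rewrite subrr normr0 ltW. Qed.

Lemma poly_bounded p : exists2 M : C, 0 <= M & forall z, disk z -> `|p.[z]| <= M.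
Proof.
exists (\sum_(i < size p) `|p`_i|); first by rewrite sumr_ge0.
move=> z zd; rewrite horner_coef; apply: le_trans (ler_norm_sum _ _ _) _.
apply: ler_sum => i _; rewrite normrM ler_piMr // normrX exprn_ile1 //.
Qed.

Lemma approximable_bounded f : approximable f ->
  exists2 M : C, 0 <= M & forall z, disk z -> `|f z| <= M.
Proof.
move=> /(_ 1 ltr01) [p hp]; have [M M0 pM] := poly_bounded p.
exists (M + 1) => [|z zd]; first exact: addr_ge0.
rewrite -(subrK p.[z] (f z)) addrC; apply: le_trans (ler_normD _ _) _.
by rewrite lerD ?pM // distrC hp.
Qed.

Lemma mul_approx (a b c d M N e : C) : `|b| <= M -> `|c| <= N ->
  `|a - b| <= e -> `|c - d| <= e -> `|a * c - b * d| <= (M + N) * e.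
Proof.
move=> bM cN ab cd.
have -> : a * c - b * d = (a - b) * c + b * (c - d) by ring.
apply: le_trans (ler_normD _ _) _; rewrite !normrM addrC mulrDl lerD //.
  by apply: ler_pM.
by rewrite mulrC; apply: ler_pM.
Qed.

Lemma approximable_mul f g : approximable f -> approximable g ->
  approximable (fun z => f z * g z).
Proof.
move=> fa ga e e0; have [M M0 fM] := approximable_bounded fa.
have [N N0 gN] := approximable_bounded ga.
have K0 : 0 < M + (N + 1) by rewrite ltr_wpDl // ltr_wpDl.
have d0 : 0 < e / (M + (N + 1)) by exact: divr_gt0.
have [n /(_ n (leqnn _)) hn] := rate_le_nat d0.
have n1 : rate n <= 1 :> C by rewrite invf_le1 ?ltr0Sn // ler1n.
have [p hp] := fa _ (rate_gt0 n); have [q hq] := ga _ (rate_gt0 n).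
exists (p * q) => z zd; rewrite hornerM.
have qN : `|q.[z]| <= N + 1.
  rewrite -(subrK (g z) q.[z]) addrC; apply: le_trans (ler_normD _ _) _.
  by rewrite lerD ?gN // (le_trans (hq z zd)).
apply: le_trans (mul_approx (fM z zd) qN (hp z zd) (hq z zd)) _.
by rewrite mulrC -ler_pdivlMr.
Qed.

Lemma fcalc_mul H (A : {linear H -> H}) f g (B D : {linear H -> H}) :
  nonexpansive A -> approximable f -> approximable g ->
  fcalc A f B -> fcalc A g D -> fcalc A (fun z => f z * g z) (B \o D).
Proof.
move=> Ac fa ga hB hD p d hp x; have [M M0 fM] := approximable_bounded fa.
have [N N0 gN] := approximable_bounded ga.
have Bb := fcalc_bound Ac fa hB fM.
pose K := (M + (N + 1)) + (N + 1) + M.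
have K0 : 0 <= K by rewrite !addr_ge0.
apply: (@le_rate _ _ _ (K * `|x|)); first by rewrite mulr_ge0.
move=> n; have n1 : rate n <= 1 :> C by rewrite invf_le1 ?ltr0Sn // ler1n.
have [q hq] := fa _ (rate_gt0 n); have [r hr] := ga _ (rate_gt0 n).
have rN z : disk z -> `|r.[z]| <= N + 1.
  move=> zd; rewrite -(subrK (g z) r.[z]) addrC; apply: le_trans (ler_normD _ _) _.
  by rewrite lerD ?gN // (le_trans (hr z zd)).
have h1 : `|poly_op A p x - poly_op A (q * r) x| <= (d + (M + (N + 1)) * rate n) * `|x|.
  rewrite -poly_opB; apply: von_neumann => // z zd.
  rewrite hornerD hornerN hornerM -(subrKA (f z * g z)).
  apply: le_trans (ler_normD _ _) _; rewrite lerD ?hp // distrC.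
  exact: mul_approx (fM z zd) (rN z zd) (hq z zd) (hr z zd).
have h2 : `|poly_op A (q * r) x - B (D x)| <= ((N + 1) + M) * rate n * `|x|.
  rewrite poly_opM -(subrKA (B (poly_op A r x))); apply: le_trans (ler_normD _ _) _.
  rewrite mulrDl mulrDl lerD //.
    apply: le_trans (hB q _ hq _) _; rewrite (mulrC (N + 1)) -mulrA.
    by rewrite ler_wpM2l ?rate_ge0 //; exact: von_neumann.
  rewrite -linearB -mulrA; apply: le_trans (Bb _) _; rewrite ler_wpM2l //.
  exact: hD.
rewrite -(subrKA (poly_op A (q * r) x)); apply: le_trans (ler_normD _ _) _.
apply: le_trans (lerD h1 h2) _; apply: eqle; rewrite /K; ring.
Qed.

End Calculus.

(** * Finite Blaschke products of isometries *)

Section Blaschke.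
Context {R : realType}.
Local Notation C := R[i].
Local Notation disk := (@closed_disk R).
Implicit Types (H K L : hilbertType R) (f g : C -> C) (p q : {poly C}).

Lemma fcalc_intertwine H K (A : {linear H -> H}) (B : {linear K -> K})
    (X : {linear H -> K}) f (FA : {linear H -> H}) (FB : {linear K -> K}) (M : C) :
  approximable f -> fcalc A f FA -> fcalc B f FB -> 0 <= M ->
  (forall x, `|X x| <= M * `|x|) -> (forall x, X (A x) = B (X x)) ->
  forall x, X (FA x) = FB (X x).
Proof.
move=> fa hA hB M0 XM XA x; apply/eqP; rewrite -subr_eq0 -normr_le0.
apply: (@le_rate _ _ _ ((M * `|x|) *+ 2)); first by rewrite mulrn_wge0 // mulr_ge0.
move=> n; have [p hp] := fa _ (rate_gt0 n); rewrite add0r -(subrKA (X (poly_op A p x))).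
apply: le_trans (ler_normD _ _) _; rewrite mulrnAl mulr2n lerD //.
  rewrite -linearB -mulrA; apply: le_trans (XM _) _; rewrite ler_wpM2l //.
  by rewrite distrC mulrC; apply: hA.
rewrite (poly_op_intertwine _ XA); apply: le_trans (hB p _ hp _) _.
by rewrite mulrC ler_wpM2r ?rate_ge0.
Qed.

(** The remainder of the geometric series is (a z)^n / (1 - a z). *)
Lemma approximable_geometric (a : C) : `|a| < 1 ->
  approximable (fun z => (1 - a * z)^-1).
Proof.
move=> a1 e e0; set r := `|a| in a1 *.
have r1 : 0 < 1 - r by rewrite subr_gt0.
(* The n + 1 terms 1, r, ..., r^n are each at least r^n, and add up to at most
   1 / (1 - r). *)
have pow n : r ^+ n <= rate n / (1 - r).
  rewrite ler_pdivlMr // /rate -[leRHS]mul1r ler_pdivlMr ?ltr0Sn //.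
  apply: le_trans (_ : (1 - r) * \sum_(i < n.+1) r ^+ i <= _).
    rewrite mulrAC (mulrC (1 - r)) ler_wpM2r ?(ltW r1) //.
    rewrite mulr_natr -[n.+1 in leLHS]card_ord -sumr_const; apply: ler_sum => i _.
    by apply: ler_wiXn2l; rewrite ?(ltW a1) ?normr_ge0 // -ltnS.
  by rewrite -opprB mulNr -subrX1 opprB lerBlDr lerDl exprn_ge0 // normr_ge0.
have d0 : 0 < e * ((1 - r) * (1 - r)) by rewrite !mulr_gt0.
have [n /(_ n (leqnn _)) hn] := rate_le_nat d0.
exists (\poly_(i < n) a ^+ i) => z zd.
have az : `|a * z| <= r by rewrite normrM ler_piMr.
have den : 1 - r <= `|1 - a * z|.
  apply: le_trans (lerB_normD _ _); rewrite normr1 normrN lerD2l lerN2 //.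
have nz : 1 - a * z != 0 by rewrite -normr_gt0; apply: lt_le_trans den.
have -> : (\poly_(i < n) a ^+ i).[z] - (1 - a * z)^-1 = - (a * z) ^+ n / (1 - a * z).
  rewrite horner_poly; apply: (mulIf nz); rewrite mulrBl mulVf // divfK //.
  rewrite (eq_bigr (fun i : 'I_n => (a * z) ^+ i)); last by move=> i _; rewrite exprMn.
  by rewrite mulrC -[1 - a * z]opprB mulNr -subrX1 opprB addrAC subrr sub0r.
rewrite mulNr normrN normrM normfV normrX ler_pdivrMr; last exact: lt_le_trans den.
apply: le_trans (_ : r ^+ n <= _); first by rewrite lerXn2r ?nnegrE ?normr_ge0.
apply: le_trans (pow n) _; rewrite ler_pdivrMr //; apply: le_trans hn _.
by rewrite mulrA ler_wpM2r ?(ltW r1) // ler_wpM2l // ltW.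
Qed.

Definition bfactor (a z : C) : C := (z - a) / (1 - a^* * z).

Lemma bfactor_den (a z : C) : `|a| < 1 -> disk z -> 1 - a^* * z != 0.
Proof.
move=> a1 zd; rewrite subr_eq0; apply: contraTneq a1 => /(congr1 Num.norm).
rewrite normr1 normrM norm_conjC => e; apply/negP => a1'.
by have := ler_piMr (normr_ge0 a) zd; rewrite -e => /le_lt_trans /(_ a1'); rewrite ltxx.
Qed.

Lemma approximable_bfactor (a : C) : `|a| < 1 -> approximable (bfactor a).
Proof.
move=> a1; have a1' : `|a^*| < 1 by rewrite norm_conjC.
have := approximable_mul (approximable_poly ('X - a%:P)) (approximable_geometric a1').
by apply: approximable_ext => z zd; rewrite hornerXsubC.
Qed.

Lemma poly_op_1BX H (A : {linear H -> H}) a x :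
  poly_op A (1 - a *: 'X) x = x - a *: A x.
Proof.
rewrite poly_opB -[1]/(1%:P) poly_opC scale1r -[_ *: _]addr0 poly_op_linear_poly.
rewrite -['X]mul1r poly_opMX -[1]/(1%:P) poly_opC scale1r.
by rewrite /poly_op size_poly0 big_ord0 addr0.
Qed.

(** E is 1 / (1 - a z) in the functional calculus of A. *)
Lemma resolvent H (A : {linear H -> H}) (a : C) : nonexpansive A -> `|a| < 1 ->
  exists E : {linear H -> H}, forall y, E y - a *: A (E y) = y.
Proof.
move=> Ac a1; have ga := approximable_geometric a1.
have [E hE] := fcalc_exists Ac ga; exists E => y.
pose q : {poly C} := 1 - a *: 'X.
have ql := poly_op_linear A q.
have hq : fcalc A (fun z => q.[z]) (mklinear ql) by exact: fcalc_poly.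
have h := fcalc_mul Ac (approximable_poly q) ga hq hE.
have h1 : fcalc A (fun z => (1 : {poly C}).[z]) (mklinear ql \o E).
  apply: fcalc_ext h => z zd; rewrite hornerD hornerN hornerZ hornerX hornerC divff //.
  by rewrite -[a]conjCK bfactor_den ?norm_conjC.
have := fcalc_unique (approximable_poly 1) h1 (@fcalc_poly _ _ _ 1 Ac) y.
by rewrite -[1]/(1%:P) poly_opC scale1r /= poly_op_1BX.
Qed.

(** The identity b_a(z) (1 - conj a z) = z - a in the functional calculus. Since
   1 - conj a A is onto, it describes b_a(A) completely. *)
Lemma fcalc_bfactor H (A B : {linear H -> H}) (a : C) : nonexpansive A -> `|a| < 1 ->
  fcalc A (bfactor a) B -> forall x, B (x - a^* *: A x) = A x - a *: x.
Proof.
move=> Ac a1 hB x; have ba := approximable_bfactor a1.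
pose q : {poly C} := 1 - a^* *: 'X; pose r : {poly C} := 1 * 'X - a%:P.
have rA y : poly_op A r y = A y - a *: y.
  by rewrite poly_opB poly_opMX -[1]/(1%:P) !poly_opC scale1r.
have ql := poly_op_linear A q.
have hq : fcalc A (fun z => q.[z]) (mklinear ql) by exact: fcalc_poly.
have h := fcalc_mul Ac ba (approximable_poly q) hB hq.
have h1 : fcalc A (fun z => r.[z]) (B \o mklinear ql).
  apply: fcalc_ext h => z zd; rewrite /r /q mul1r hornerXsubC hornerD hornerN hornerZ hornerX hornerC.
  by rewrite divfK // bfactor_den.
have := fcalc_unique (approximable_poly r) h1 (@fcalc_poly _ _ _ r Ac) x.
by rewrite /= poly_op_1BX rA.
Qed.

Section Factor.
Variables (H : hilbertType R) (A B : {linear H -> H}) (a : C).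
Hypotheses (a1 : `|a| < 1) (Ai : isometric A) (hB : fcalc A (bfactor a) B).

Let Ac := isometric_nonexpansive Ai.

(** At x = y - conj a A y the claim reads |A y - a y| = |y - conj a A y|, which
   expands to |A y| = |y|. *)
Lemma bfactor_isometric : isometric B.
Proof.
have [E EK] := resolvent (a := a^*) Ac ltac:(by rewrite norm_conjC).
move=> x; rewrite -{1 2}(EK x) fcalc_bfactor //; move: (E x) => y.
apply/eqP; rewrite -(eqrXn2 (n := 2)) //; apply/eqP.
rewrite -!hdot_norm !hdotBl !hdotBr !hdotZl !hdotZr !(isometric_hdot Ai) (hdotC (A y) y) conjCK.
by rewrite (hdotC y (A y)); ring.
Qed.

(** A - a = A (1 - a A^-1), and 1 - a A^-1 is onto. *)
Lemma bfactor_bijective : bijective_isometry A -> bijective_isometry B.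
Proof.
move=> Au; have [A' [AK A'K A'u]] := bijective_isometry_inv Au.
have [E EK] := resolvent (isometric_nonexpansive A'u.1) a1.
apply: onto_isometry_bijective bfactor_isometric _ => w.
pose y := E (A' w); exists (y - a^* *: A y); rewrite fcalc_bfactor //.
have := congr1 A (EK (A' w)); rewrite linearB linearZ /= !A'K.
by [].
Qed.

(** If u = b_a(A) is unitary then A (1 + conj a u) = u (1 + a u^-1), and the
   right-hand side is onto. *)
Lemma bfactor_bijective_inv : bijective_isometry B -> bijective_isometry A.
Proof.
move=> Bu; have [B' [BK B'K B'u]] := bijective_isometry_inv Bu.
have [E EK] := resolvent (a := - a) (isometric_nonexpansive B'u.1) ltac:(by rewrite normrN).
have AB x : A (B x) = B (A x).
  apply: (fcalc_intertwine (approximable_bfactor a1) hB hB ler01) => // y.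
  by rewrite mul1r Ac.
apply: onto_isometry_bijective Ai _ => y; pose x := E (B' y).
exists (x + a^* *: B x); rewrite linearD linearZ /= AB.
have := fcalc_bfactor Ac a1 hB x; rewrite linearB linearZ /= => /eqP.
rewrite subr_eq addrAC -subr_eq => /eqP e.
have := congr1 B (EK (B' y)); rewrite scaleNr opprK linearD linearZ /= !B'K => <-.
by rewrite -e opprK.
Qed.

End Factor.

Section FiniteProducts.

Fixpoint blaschke (c : C) (s : seq C) (z : C) : C :=
  if s is a :: s' then bfactor a z * blaschke c s' z else c.

Variable c : C.
Hypothesis c1 : `|c| = 1.
Implicit Type s : seq C.

Definition zeros_in_disk s := forall a, a \in s -> `|a| < 1.

Lemma zeros_in_disk_cons a s : zeros_in_disk (a :: s) -> `|a| < 1 /\ zeros_in_disk s.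
Proof.
by move=> h; split=> [|b bs]; apply: h; rewrite inE ?eqxx ?bs ?orbT.
Qed.

Lemma approximable_blaschke s : zeros_in_disk s -> approximable (blaschke c s).
Proof.
elim: s => [|a s IH] /= => [_|/zeros_in_disk_cons [a1 /IH s1]].
  by have := approximable_poly c%:P; apply: approximable_ext => z _; rewrite hornerC.
exact: approximable_mul (approximable_bfactor a1) s1.
Qed.

Lemma fcalc_blaschke_cons H (A B : {linear H -> H}) a s : nonexpansive A ->
  zeros_in_disk (a :: s) -> fcalc A (blaschke c (a :: s)) B ->
  exists (Ba Bs : {linear H -> H}), [/\ fcalc A (bfactor a) Ba,
    fcalc A (blaschke c s) Bs & forall x, B x = Ba (Bs x)].
Proof.
move=> Ac as1 hB; have [a1 s1] := zeros_in_disk_cons as1.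
have aa := approximable_bfactor a1; have sa := approximable_blaschke s1.
have [Ba hBa] := fcalc_exists Ac aa; have [Bs hBs] := fcalc_exists Ac sa.
exists Ba, Bs; split=> // x.
exact: fcalc_unique (approximable_blaschke as1) hB (fcalc_mul Ac aa sa hBa hBs) x.
Qed.

Lemma fcalc_blaschke_nil H (A B : {linear H -> H}) : nonexpansive A ->
  fcalc A (blaschke c [::]) B -> forall x, B x = c *: x.
Proof.
move=> Ac hB x; rewrite -(poly_opC A).
apply: (fcalc_unique (approximable_poly c%:P)) (@fcalc_poly _ _ _ _ Ac) x.
by apply: fcalc_ext hB => z _; rewrite hornerC.
Qed.

Lemma blaschke_isometric H (A B : {linear H -> H}) s : zeros_in_disk s ->
  isometric A -> fcalc A (blaschke c s) B -> isometric B.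
Proof.
move=> s1 Ai; have Ac := isometric_nonexpansive Ai.
elim: s B s1 => [|a s IH] B s1 hB x.
  by rewrite (fcalc_blaschke_nil Ac hB) hnormZ c1 mul1r.
have [Ba [Bs [hBa hBs ->]]] := fcalc_blaschke_cons Ac s1 hB.
have [a1 /IH Is] := zeros_in_disk_cons s1.
by rewrite (bfactor_isometric a1 Ai hBa) Is.
Qed.

Lemma blaschke_bijective H (A B : {linear H -> H}) s : zeros_in_disk s ->
  bijective_isometry A -> fcalc A (blaschke c s) B -> bijective_isometry B.
Proof.
move=> s1 Au; have Ai := Au.1; have Ac := isometric_nonexpansive Ai.
elim: s B s1 => [|a s IH] B s1 hB; apply: onto_isometry_bijective; try exact: blaschke_isometric hB.
  move=> y; exists (c^-1 *: y); rewrite (fcalc_blaschke_nil Ac hB) scalerA divff ?scale1r //.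
  by rewrite -normr_eq0 c1 oner_eq0.
have [Ba [Bs [hBa hBs BE]]] := fcalc_blaschke_cons Ac s1 hB.
have [a1 /IH /(_ hBs) Is] := zeros_in_disk_cons s1.
have [D [_ BaD _]] := bijective_isometry_inv (bfactor_bijective a1 Ai hBa Au).
have [D' [_ BsD _]] := bijective_isometry_inv Is.
by move=> y; exists (D' (D y)); rewrite BE BsD BaD.
Qed.

(** The outer factor of a surjective product is onto, and a single factor is
   enough to recover A. *)
Lemma bijective_of_blaschke H (A B : {linear H -> H}) s : zeros_in_disk s -> s != [::] ->
  isometric A -> fcalc A (blaschke c s) B -> bijective_isometry B -> bijective_isometry A.
Proof.
case: s => // a s s1 _ Ai hB Bu; have Ac := isometric_nonexpansive Ai.
have [Ba [Bs [hBa hBs BE]]] := fcalc_blaschke_cons Ac s1 hB.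
have [a1 _] := zeros_in_disk_cons s1; apply: (bfactor_bijective_inv a1 Ai hBa).
apply: onto_isometry_bijective (bfactor_isometric a1 Ai hBa) _ => y.
by have [D [_ BD _]] := bijective_isometry_inv Bu; exists (Bs (D y)); rewrite -BE BD.
Qed.

End FiniteProducts.

End Blaschke.

(** * Series of orthogonal vectors *)

Section Limits.
Context {R : realType}.
Local Notation C := R[i].
Implicit Types (H K L : hilbertType R).

Definition tends H (u : nat -> H) (l : H) :=
  forall e : C, 0 < e -> exists N, forall n, (N <= n)%N -> `|u n - l| <= e.

Lemma tends_unique H (u : nat -> H) l l' : tends u l -> tends u l' -> l = l'.
Proof.
move=> ul ul'; apply/eqP; rewrite -subr_eq0 -normr_le0; apply/ler_addgt0Pr => e e0.
have e20 : 0 < e / 2 by rewrite divr_gt0.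
have [N hN] := ul _ e20; have [N' hN'] := ul' _ e20; set n := maxn N N'.
rewrite add0r -(subrKA (u n)) [e]splitr; apply: le_trans (ler_normD _ _) _.
by rewrite lerD ?hN' ?leq_maxr // distrC hN ?leq_maxl.
Qed.

Lemma tends_map H K (f : {linear H -> K}) u l : nonexpansive f -> tends u l ->
  tends (f \o u) (f l).
Proof.
move=> fc ul e e0; have [N hN] := ul e e0; exists N => n Nn.
by rewrite /= -linearB (le_trans (fc _)) // hN.
Qed.

Lemma tends_lin H a (u v : nat -> H) l k : tends u l -> tends v k ->
  tends (fun n => a *: u n + v n) (a *: l + k).
Proof.
move=> ul vk e e0; have e20 : 0 < e / 2 by rewrite divr_gt0.
have d0 : 0 < e / 2 / (`|a| + 1) by rewrite divr_gt0 // ltr_wpDl.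
have [N hN] := ul _ d0; have [N' hN'] := vk _ e20; exists (maxn N N') => n.
rewrite geq_max => /andP[Nn N'n]; rewrite opprD addrACA -scalerBr.
apply: le_trans (ler_normD _ _) _; rewrite [e]splitr lerD ?hN' // hnormZ.
apply: le_trans (ler_wpM2l (normr_ge0 a) (hN n Nn)) _.
by rewrite mulrCA ger_pMr // ler_pdivrMr ?mul1r ?lerDl // ltr_wpDl.
Qed.

Lemma tends_shift H (u : nat -> H) l k : tends u l -> tends (fun n => u (k + n)%N) l.
Proof.
by move=> ul e e0; have [N hN] := ul e e0; exists N => n Nn; rewrite hN // (leq_trans Nn) ?leq_addl.
Qed.

Lemma tends_cst H (l : H) : tends (fun=> l) l.
Proof. by move=> e e0; exists 0%N => n _; rewrite subrr normr0 ltW. Qed.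

Lemma tends_norm_le H (u : nat -> H) l (M : C) : tends u l -> (forall n, `|u n| <= M) ->
  `|l| <= M.
Proof.
move=> ul uM; apply/ler_addgt0Pr => e e0; have [N /(_ N (leqnn _)) hN] := ul e e0.
rewrite -(subrK (u N) l) addrC; apply: le_trans (ler_normD _ _) _.
by rewrite lerD // distrC.
Qed.

(** By orthogonality, the squared distance of two partial sums is the difference
   of their squared norms, and these increase and are bounded. *)
Lemma orthogonal_series H (v : nat -> H) (B : C) :
  (forall m n, m != n -> hdot (v m) (v n) = 0) ->
  (forall N, `|\sum_(n < N) v n| ^+ 2 <= B) ->
  exists l, tends (fun N => \sum_(n < N) v n) l.
Proof.
move=> vo vB; pose P N := \sum_(n < N) v n; pose w N : C := `|P N| ^+ 2.
have sl (I : Type) (s : seq I) (G : I -> H) y :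
    (forall i, hdot (G i) y = 0) -> hdot (\sum_(i <- s) G i) y = 0.
  by move=> G0; elim: s => [|i s IH]; rewrite ?big_nil ?hdot0l // big_cons hdotDl IH G0 addr0.
have PB M N : (N <= M)%N -> `|P M - P N| ^+ 2 = w M - w N.
  move=> /subnK <-; rewrite addnC /w.
  have -> : P (N + (M - N))%N = P N + \sum_(n < M - N) v (N + n)%N by rewrite /P big_split_ord.
  have o : hdot (P N) (\sum_(n < M - N) v (N + n)%N) = 0.
    apply: (sl) => i; rewrite hdotC sl ?conjC0 // => j; apply: vo.
    by rewrite gtn_eqF // (leq_trans (ltn_ord i)) ?leq_addr.
  by rewrite (hnormD_orth o) [P N + _]addrC addrK [RHS]addrC addKr.
have ReE (z : H) : (complex.Re (`|z| ^+ 2))%:C%C = `|z| ^+ 2.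
  by rewrite RRe_real // rpredX ?normr_real.
have B0 : 0 <= B by apply: le_trans (vB 0%N); rewrite exprn_ge0.
pose W := [set complex.Re (w N) | N in [set: nat]].
have Wsup : has_sup W.
  split; first by exists (complex.Re (w 0%N)); exists 0%N.
  exists (complex.Re B) => _ [N _ <-].
  by have := vB N; rewrite lecE => /andP[_].
have wm M N : (N <= M)%N -> w N <= w M by move=> NM; rewrite -subr_ge0 -PB // exprn_ge0.
apply: (@complete_limit C H P) => e e0.
have [r r0 er] := posC_real (exprn_gt0 2 e0).
have [_ [N _ <-] hN] := sup_adherent r0 Wsup.
have key M : (N <= M)%N -> w M - w N <= e ^+ 2.
  move=> NM; rewrite lerBlDr er /w -[`|P M| ^+ 2]ReE -[`|P N| ^+ 2]ReE -rmorphD lecR.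
  have : complex.Re (w M) <= sup W by apply: sup_ubound; [case: Wsup | exists M].
  by move=> /le_trans; apply; rewrite -lerBlDl ltW.
have half M M' : (M <= M')%N -> (N <= M)%N -> `|P M' - P M| <= e.
  move=> MM NM; rewrite -ler_sqr ?nnegrE ?(ltW e0) // PB //.
  apply: le_trans (key M' (leq_trans NM MM)); rewrite lerD2l lerN2; exact: wm.
exists N => m n Nm Nn; have [mn|/ltnW nm] := leqP m n; first by rewrite distrC half.
exact: half.
Qed.

End Limits.

(** * Lifting the intertwining relation to an isometry *)

Section ConstantTail.
Context {R : realType}.
Local Notation C := R[i].
Implicit Types (H K L : hilbertType R).

(** p and q are the adjoints of the embeddings of H and of the first copy of L,
   so the last clause is Bessel's inequality. *)
Lemma constant_tail_coordinates H L K (i : forall n, {linear constant_tail H L n -> K}) :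
  is_hilbert_sum i ->
  exists (p : {linear K -> H}) (q : {linear K -> L}),
    (forall x y, p (i 0%N x + i 1%N y) = x) /\ (forall x y, q (i 0%N x + i 1%N y) = y) /\
    forall z, `|p z| ^+ 2 + `|q z| ^+ 2 <= `|z| ^+ 2.
Proof.
move=> [iI io iE iU].
have zl (V W : lmodType C) : linear (fun _ : V => 0 : W).
  by move=> a x y; rewrite scaler0 addr0.
pose f n : {linear constant_tail H L n -> H} :=
  match n return {linear constant_tail H L n -> H} with 0 => idfun | n.+1 => mklinear (zl _ _) end.
pose g n : {linear constant_tail H L n -> L} :=
  match n return {linear constant_tail H L n -> L} with 1 => idfun | _ => mklinear (zl _ _) end.
have fc n : nonexpansive (f n) by case: n => [|n] x //=; rewrite normr0.
have gc n : nonexpansive (g n) by case: n => [|[|n]] x //=; rewrite normr0.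
have [m n x y mn|p [pE pc _]] := iE H f fc.
  by case: m x mn => [|m] x; case: n y => [|n] y //= mn; rewrite ?hdot0l ?hdot0r.
have [m n x y mn|q [qE qc _]] := iE L g gc.
  by case: m x mn => [|[|m]] x; case: n y => [|[|n]] y //= mn; rewrite ?hdot0l ?hdot0r.
have p0 x : p (i 0%N x) = x by exact: (pE 0%N).
have p1 x : p (i 1%N x) = 0 by exact: (pE 1%N).
have q0 x : q (i 0%N x) = 0 by exact: (qE 0%N).
have q1 x : q (i 1%N x) = x by exact: (qE 1%N).
have o01 (h : H) (d : L) : hdot (i 0%N h) (i 1%N d) = 0 by exact: (io 0%N 1%N h d isT).
exists p, q; split=> [x y|]; first by rewrite linearD /= p0 p1 addr0.
split=> [x y|z]; first by rewrite linearD /= q0 q1 add0r.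
have pA := left_inverse_adjoint (iI 0%N) pc p0.
have qA := left_inverse_adjoint (iI 1%N) qc q1.
pose y := i 0%N (p z) + i 1%N (q z).
have yE : `|p z| ^+ 2 + `|q z| ^+ 2 = `|y| ^+ 2.
  by rewrite /y hnormD_orth ?o01 // (iI 0%N) (iI 1%N).
have zy : hdot z y = `|y| ^+ 2 by rewrite -yE hdotDr -pA -qA !hdot_norm.
rewrite yE ler_sqr ?nnegrE //; have [->//|y0] := eqVneq `|y| 0.
have yp : 0 < `|y| by rewrite lt_def y0 normr_ge0.
by rewrite -(ler_pM2r yp) -expr2 -[_ ^+ 2]ger0_norm ?exprn_ge0 // -zy hdot_CS.
Qed.

End ConstantTail.

Section Lifting.
Context {R : realType}.
Local Notation C := R[i].
Implicit Types (H K L : hilbertType R).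
Variables (c : C) (s : seq C).
Hypotheses (c1 : `|c| = 1) (s1 : zeros_in_disk s).
Local Notation b := (blaschke c s).

Let ab : approximable b := approximable_blaschke c s1.

(** Let V be the isometric coextension of A, acting on K = H + L + L + ..., with
   defect operator Def : H -> L and compression p : K -> H. A lift S of T is a
   sequence of components s_0 = T p, s_1, s_2, ..., and V S = S b(V) means that
   s_1 b(V) = Def T p and s_(n+2) b(V) = s_(n+1). Let q : K -> Q be the defect
   operator of T p. Since b(V) is isometric and T p b(V) = A T p,
     |q (b(V) x)|^2 = |q x|^2 + |Def T p x|^2,
   so q (b(V) x) |-> (q x, Def T p x) extends to a contraction (Gam, F) defined
   on Q. The components s_(n+1) = F Gam^n q solve the recursion, and their
   square sum telescopes to at most |q x|^2 = |x|^2 - |T p x|^2. *)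
Lemma intertwining_lift H (A T B : {linear H -> H}) :
  nonexpansive A -> nonexpansive T -> fcalc A b B -> (forall x, A (T x) = T (B x)) ->
  exists (K : hilbertType R) (j : {linear H -> K}) (p : {linear K -> H})
    (V S D : {linear K -> K}),
    [/\ isometric j /\ nonexpansive p, isometric V, nonexpansive S, fcalc V b D &
     [/\ forall x, p (j x) = x, forall x, p (V x) = A (p x),
        forall x, p (S x) = T (p x) & forall x, V (S x) = S (D x)]].
Proof.
move=> Ac Tc hB AT; have [L [Def [AD _]]] := defect_space Ac.
have [K [i [V [p [iS [Vi pc] [V0 Vn] p0 pV]]]]] := isometric_coextension AD.
have [iI io iE iU] := iS; have Vc := isometric_nonexpansive Vi.
have [D hD] := fcalc_exists Vc ab.
have Di : isometric D := blaschke_isometric c1 s1 Vi hD.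
have pD x : p (D x) = B (p x).
  by apply: (fcalc_intertwine ab hD hB ler01) => // y; rewrite mul1r pc.
have p1 n (d : L) : p (i n.+1 d) = 0.
  apply: hdot_eq0 => h; rewrite (left_inverse_adjoint (iI 0%N) pc p0).
  exact: (io n.+1 0%N d h isT).
pose T' : {linear K -> H} := T \o p.
have T'c : nonexpansive T' by exact: nonexpansive_comp.
have T'D x : T' (D x) = A (T' x) by rewrite /= pD AT.
have [Q [q [Tq _]]] := defect_space T'c.
pose S0 : {linear K -> L} := Def \o T'.
have qD x : `|q (D x)| ^+ 2 = `|q x| ^+ 2 + `|S0 x| ^+ 2.
  apply: (addrI (`|T' (D x)| ^+ 2)); rewrite Tq Di -(Tq x) T'D -(AD (T' x)).
  by rewrite addrAC addrA.
have [M [k kS]] := hilbert_sum (constant_tail Q L).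
have [kI ko kE kU] := kS.
have o01 (h : Q) (d : L) : hdot (k 0%N h) (k 1%N d) = 0 by exact: (ko 0%N 1%N h d isT).
have thl : linear (fun x => k 0%N (q x) + k 1%N (S0 x)).
  by move=> a x y; rewrite !linearP addrACA -scalerDr.
have thn x : `|mklinear thl x| <= `|q (D x)|.
  rewrite -ler_sqr ?nnegrE //= hnormD_orth ?o01 // (kI 0%N) (kI 1%N) qD //.
have [G [GE Gc]] := @douglas R K Q M (q \o D) (mklinear thl) thn.
have [g0 [g1 [g0E [g1E g01]]]] := constant_tail_coordinates kS.
pose Gam : {linear Q -> Q} := g0 \o G; pose F : {linear Q -> L} := g1 \o G.
have GamE x : Gam (q (D x)) = q x by rewrite /= -[q (D x)]/((q \o D) x) GE /= g0E.
have FE x : F (q (D x)) = S0 x by rewrite /= -[q (D x)]/((q \o D) x) GE /= g1E.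
have GF z : `|Gam z| ^+ 2 + `|F z| ^+ 2 <= `|z| ^+ 2.
  by apply: le_trans (g01 _) _; rewrite ler_sqr ?nnegrE ?Gc.
have sl n : linear (fun x => F (iter n Gam (q x))).
  by move=> a x y; rewrite linearP iter_lin linearP.
pose sn n : {linear K -> constant_tail H L n} :=
  match n return {linear K -> constant_tail H L n} with 0 => T' | n.+1 => mklinear (sl n) end.
have s0D x : sn 0%N (D x) = A (sn 0%N x) by exact: T'D.
have s1D x : sn 1%N (D x) = Def (sn 0%N x) by exact: FE.
have snD n x : sn n.+2 (D x) = sn n.+1 x.
  by rewrite -[LHS]/(F (iter n.+1 Gam (q (D x)))) iterSr GamE.
pose P N x := \sum_(n < N) i n (sn n x).
have vo x m n : m != n -> hdot (i m (sn m x)) (i n (sn n x)) = 0 by exact: io.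
have PB x N : `|P N x| ^+ 2 <= `|x| ^+ 2.
  rewrite (@pythagoras_sum R K (fun n => i n (sn n x)) N (vo x)).
  case: N => [|N]; first by rewrite big_ord0 exprn_ge0.
  apply: le_trans (_ : \sum_(n < N.+1) `|i n (sn n x)| ^+ 2 + `|iter N Gam (q x)| ^+ 2 <= _).
    by rewrite lerDl exprn_ge0.
  elim: N => [|N IH]; first by rewrite big_ord_recr big_ord0 /= add0r (iI 0%N) -[T (p x)]/(T' x) Tq.
  apply: le_trans IH; rewrite big_ord_recr /= -addrA lerD2l (iI N.+1) addrC.
  exact: GF.
have Pl N : linear (P N).
  move=> a x y; rewrite /P scaler_sumr -big_split /=; apply: eq_bigr => n _.
  by rewrite !linearP.
have /choice [S hS] : forall x, exists y, tends (P^~ x) y.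
  by move=> x; apply: orthogonal_series (vo x) (PB x).
have Sl : linear S.
  move=> a x y; apply: (tends_unique (hS _)).
  by have := tends_lin a (hS x) (hS y); congr tends; apply/funext => N; rewrite Pl.
have Sc : nonexpansive S.
  move=> x; apply: tends_norm_le (hS x) _ => N.
  by rewrite -ler_sqr ?nnegrE.
have VP N x : V (P N.+1 x) = P N.+2 (D x).
  elim: N => [|N IH].
    have -> : P 1%N x = i 0%N (sn 0%N x) by rewrite /P big_ord1.
    have -> : P 2%N (D x) = i 0%N (sn 0%N (D x)) + i 1%N (sn 1%N (D x)).
      by rewrite /P big_ord_recr big_ord1.
    by rewrite V0 s0D s1D.
  rewrite /P big_ord_recr linearD [RHS]big_ord_recr -/(P N.+1 x) -/(P N.+2 (D x)) IH.
  congr (_ + _); rewrite [LHS](Vn N) [in RHS](snD N) //.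
exists K, (i 0%N), p, V, (mklinear Sl), D; split=> //; first by split; [exact: (iI 0%N)|].
split=> // x /=.
  apply: (tends_unique (tends_map pc (tends_shift 1 (hS x)))).
  have := tends_cst (T (p x)); congr tends; apply/funext => N.
  rewrite /= /P add1n big_ord_recl linearD /= p0 linear_sum big1 ?addr0 // => n _.
  exact: p1.
apply: (tends_unique (tends_map Vc (tends_shift 1 (hS x)))).
have := tends_shift 2 (hS (D x)); congr tends; apply/funext => N.
by rewrite /= add1n VP.
Qed.

End Lifting.

(** * Extending the isometry to a unitary *)

Section Unitarization.
Context {R : realType}.
Local Notation C := R[i].
Implicit Types (H K L : hilbertType R).

(** The adjoint is read off from an isometry (S, D) into a larger space, whose
   contractive left inverse is provided by the factorisation lemma. *)
Lemma adjoint_exists H (S : {linear H -> H}) : nonexpansive S ->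
  exists S' : {linear H -> H}, nonexpansive S' /\ forall x y, hdot (S x) y = hdot x (S' y).
Proof.
move=> Sc; have [L [D [SD _]]] := defect_space Sc.
have [K [i [iI io _ _]]] := hilbert_sum (constant_tail H L).
have o01 (h : H) (d : L) : hdot (i 0%N h) (i 1%N d) = 0 by exact: (io 0%N 1%N h d isT).
have wl : linear (fun x => i 0%N (S x) + i 1%N (D x)).
  by move=> a x y; rewrite !linearP addrACA -scalerDr.
have wI : isometric (mklinear wl).
  move=> x; apply/eqP; rewrite -(eqrXn2 (n := 2)) //; apply/eqP.
  by rewrite hnormD_orth ?o01 // (iI 0%N) (iI 1%N) SD.
have [p [pw pc]] := @douglas R H K H (mklinear wl) idfun (fun x => eqle (esym (wI x))).
exists (p \o i 0%N); split=> [x|x y] /=; first by rewrite (le_trans (pc _)) // (iI 0%N).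
rewrite [RHS]hdotC (left_inverse_adjoint wI pc pw) -[RHS]hdotC /= hdotDl (isometric_hdot (iI 0%N)).
by rewrite (hdotC (i 0%N y)) o01 conjC0 addr0.
Qed.

Variables (c : C) (s : seq C).
Hypotheses (c1 : `|c| = 1) (s1 : zeros_in_disk s) (s0 : s != [::]).
Local Notation b := (blaschke c s).

Let ab : approximable b := approximable_blaschke c s1.

(** Along the direct limit of D = b(V), D becomes unitary, hence so does V. On
   the n-th level, which stands for D^-n K, the extension of S is forced to be
   U^-n S by U S = S D. *)
Lemma unitary_extension K (V S D : {linear K -> K}) :
  isometric V -> nonexpansive S -> fcalc V b D -> (forall x, V (S x) = S (D x)) ->
  exists (K' : hilbertType R) (e : {linear K -> K'}) (U S' D' : {linear K' -> K'}),
    [/\ isometric e, bijective_isometry U, nonexpansive S', fcalc U b D' &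
     [/\ forall x, U (S' x) = S' (D' x), forall x, U (e x) = e (V x) &
         forall x, S' (e x) = e (S x)]].
Proof.
move=> Vi Sc hD VS; have Vc := isometric_nonexpansive Vi.
have Di : isometric D := blaschke_isometric c1 s1 Vi hD.
have Dc := isometric_nonexpansive Di.
have VD x : V (D x) = D (V x).
  by apply: (fcalc_intertwine ab hD hD ler01) => // y; rewrite mul1r Vc.
have [K' [e [eI eD eE eU]]] := direct_limit Di.
have ec n : nonexpansive (e n) := isometric_nonexpansive (eI n).
have [|n x|U [Ue Uc UI]] := eE K' (fun n => e n \o V).
- by move=> n; exact: nonexpansive_comp.
- by rewrite /= VD eD.
have {}Ue n x : U (e n x) = e n (V x) := Ue n x.
have {}UI : isometric U by apply: UI => n; exact: isometric_comp.
have [D' hD'] := fcalc_exists Uc ab.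
have D'i : isometric D' := blaschke_isometric c1 s1 UI hD'.
have D'e n x : D' (e n x) = e n (D x).
  symmetry; apply: (fcalc_intertwine ab hD hD' ler01) => y; first by rewrite mul1r ec.
  by rewrite Ue.
have [|n x|E [Ee Ec _]] := eE K' (fun n => e n.+1); [by move=> n|by rewrite eD|].
have D'u : bijective_isometry D'.
  apply: (onto_isometry_bijective D'i) => y; exists (E y).
  apply: (eU K' (D' \o E) idfun) => //; first exact: nonexpansive_comp (isometric_nonexpansive D'i) Ec.
  by move=> n x /=; rewrite Ee D'e eD.
have Uu : bijective_isometry U := bijective_of_blaschke s1 s0 UI hD' D'u.
have [W [UW WU Wu]] := bijective_isometry_inv Uu.
have fl n : linear (fun x => iter n W (e 0%N (S x))).
  by move=> a x y; rewrite !linearP iter_lin.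
have [|n x|S' [Se S'c _]] := eE K' (fun n => mklinear (fl n)).
- move=> n x /=; rewrite (iter_isometric n Wu.1) eI; exact: Sc.
- by rewrite /= -iterS iterSr -VS -(Ue 0%N) UW.
have {}Se n x : S' (e n x) = iter n W (e 0%N (S x)) := Se n x.
exists K', (e 0%N), U, S', D'; split=> //; split=> [|x|x]; [|by rewrite Ue|by rewrite Se].
apply: (eU K' (U \o S') (S' \o D')).
- exact: nonexpansive_comp.
- exact: nonexpansive_comp S'c (isometric_nonexpansive D'i).
- case=> [|n] x; rewrite /= D'e ?eD !Se /= ?WU //.
  by rewrite -VS -(Ue 0%N).
Qed.

End Unitarization.

(** * Bounded maps *)

Section BoundedMaps.
Context {R : realType}.
Local Notation C := R[i].
Implicit Types (H K L : hilbertType R).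

Definition bounded H K (f : H -> K) := exists2 M : C, 0 <= M & forall x, `|f x| <= M * `|x|.

Lemma bounded_nonexpansive H K (f : H -> K) : nonexpansive f -> bounded f.
Proof. by move=> fc; exists 1 => // x; rewrite mul1r. Qed.

Lemma bounded_comp H K L (f : K -> L) (g : H -> K) :
  bounded f -> bounded g -> bounded (fun x => f (g x)).
Proof.
move=> [M M0 fM] [N N0 gN]; exists (M * N) => [|x]; first exact: mulr_ge0.
by apply: le_trans (fM _) _; rewrite -mulrA ler_wpM2l.
Qed.

Lemma bounded_add H K (f g : H -> K) :
  bounded f -> bounded g -> bounded (fun x => f x + g x).
Proof.
move=> [M M0 fM] [N N0 gN]; exists (M + N) => [|x]; first exact: addr_ge0.
by apply: le_trans (ler_normD _ _) _; rewrite mulrDl lerD.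
Qed.

Lemma bounded_scale H K a (f : H -> K) : bounded f -> bounded (fun x => a *: f x).
Proof.
move=> [M M0 fM]; exists (`|a| * M) => [|x]; first exact: mulr_ge0.
by rewrite hnormZ -mulrA; apply: ler_wpM2l.
Qed.

Lemma bounded_sub H K (f g : H -> K) :
  bounded f -> bounded g -> bounded (fun x => f x - g x).
Proof.
move=> fb [N N0 gN]; apply: (bounded_add fb); exists N => // x.
by rewrite normrN.
Qed.

Lemma bounded_sum H K d (f : nat -> H -> K) :
  (forall k, (k < d)%N -> bounded (f k)) -> bounded (fun x => \sum_(k < d) f k x).
Proof.
elim: d => [|d IH] fb.
  by exists 0 => // x; rewrite big_ord0 normr0 mul0r.
have [M M0 hM] := bounded_add (IH (fun k kd => fb k (ltnW kd))) (fb d (leqnn _)).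
by exists M => // x; rewrite big_ord_recr; exact: hM.
Qed.

Lemma dense_extend_bounded (E : lmodType C) K L (i : {linear E -> K})
    (f : {linear E -> L}) (M : C) : dense_map i -> 0 <= M ->
  (forall x, `|f x| <= M * `|i x|) ->
  exists F : {linear K -> L}, bounded F /\ forall x, F (i x) = f x.
Proof.
move=> id M0 fM; have M1 : 0 < M + 1 by rewrite ltr_wpDl.
have gl : linear (fun x => (M + 1)^-1 *: f x).
  by move=> a x y; rewrite linearP scalerDr !scalerA mulrC.
have gM x : `|mklinear gl x| <= `|i x|.
  rewrite /= hnormZ ger0_norm ?invr_ge0 ?(ltW M1) // mulrC ler_pdivrMr // mulrC.
  by apply: le_trans (fM x) _; rewrite ler_wpM2r ?lerDl.
have [G [Gi Gc _]] := dense_extend id gM.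
have Fl : linear (fun y => (M + 1) *: G y).
  by move=> a x y; rewrite linearP scalerDr !scalerA mulrC.
exists (mklinear Fl); split; first exact/bounded_scale/bounded_nonexpansive.
by move=> x; rewrite /= Gi /= scalerA divff ?scale1r ?gt_eqF.
Qed.

Lemma dense_eq_bounded (E : lmodType C) K L (i : E -> K) (f g : {linear K -> L}) :
  dense_map i -> bounded f -> bounded g -> (forall x, f (i x) = g (i x)) ->
  forall x, f x = g x.
Proof. by move=> id [M M0 fM] [N N0 gN]; exact: dense_eq id M0 N0 fM gN. Qed.

Lemma fcalc_intertwine_bounded H K (A : {linear H -> H}) (B : {linear K -> K})
    (X : {linear H -> K}) f (FA : {linear H -> H}) (FB : {linear K -> K}) :
  approximable f -> fcalc A f FA -> fcalc B f FB -> bounded X ->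
  (forall x, X (A x) = B (X x)) -> forall x, X (FA x) = FB (X x).
Proof. by move=> fa hA hB [M M0 XM]; exact: fcalc_intertwine fa hA hB M0 XM. Qed.

End BoundedMaps.

(** * Blaschke roots of unitaries *)

Section BlaschkeRoot.
Context {R : realType}.
Local Notation C := R[i].
Implicit Types (H K L : hilbertType R).
Variables (c : C) (s : seq C).
Hypotheses (c1 : `|c| = 1) (s1 : zeros_in_disk s) (s0 : s != [::]).
Local Notation b := (blaschke c s).

Let ab : approximable b := approximable_blaschke c s1.

Variables (N : hilbertType R) (X : {linear N -> N}).
Hypothesis Xu : bijective_isometry X.

Let d := size s.
Let a k := nth 0 s k.
Let E := nat -> N.

Let a1 k : `|a k| < 1.
Proof.
have [kd|dk] := ltnP k d; first exact/s1/mem_nth.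
by rewrite /a nth_default // normr0.
Qed.

Let kap k : C := \prod_(i < k) - (a i)^*.

Let kapS k : kap k.+1 = - (a k)^* * kap k.
Proof. by rewrite /kap big_ord_recr mulrC. Qed.

Let kap_le1 k : `|kap k| <= 1.
Proof.
elim: k => [|k IH]; first by rewrite /kap big_ord0 normr1.
by rewrite kapS normrM normrN norm_conjC mulr_ile1 // ltW.
Qed.

Let loop_lt1 : `|c^* * kap d| < 1.
Proof.
rewrite normrM norm_conjC c1 mul1r; have : (0 < d)%N by rewrite lt0n size_eq0.
case: d => // n _; rewrite kapS normrM normrN norm_conjC.
by apply: le_lt_trans (ler_piMr _ (kap_le1 n)) (a1 n).
Qed.

Let Xi : isometric X := Xu.1.

Fixpoint open_loop (x : nat -> N) k : N :=
  if k is k.+1 then x k - (a k)^* *: open_loop x k else 0.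

Let open_loop_linear k : linear (open_loop^~ k).
Proof.
elim: k => [|k IH] q x y /=; first by rewrite scaler0 addr0.
by rewrite -[(q *: x + y) k]/(q *: x k + y k) IH scalerBr !scalerDr !scalerA mulrC
  opprD addrACA.
Qed.

(** The recursion gives t_d = open_loop x d + kap d *: t_0, so the condition
   X t_d = c t_0 becomes t_0 - conj c kap_d X t_0 = conj c X (open_loop x d). It
   can be solved because |kap_d| < 1. *)
Lemma feedback_exists : exists t : nat -> {linear (nat -> N) -> N},
  [/\ forall x k, t k.+1 x = x k - (a k)^* *: t k x,
      forall x, X (t d x) = c *: t 0%N x &
      exists2 M : C, 0 <= M & forall x B, (forall k, (k < d)%N -> `|x k| <= B) ->
        forall k, (k <= d)%N -> `|t k x| <= M * B].
Proof.
have [Er ErE] := resolvent (isometric_nonexpansive Xi) loop_lt1.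
pose t0 x := Er (c^* *: X (open_loop x d)).
pose tt k x := open_loop x k + kap k *: t0 x.
have t0l : linear t0.
  by move=> q x y; rewrite /t0 open_loop_linear !linearP.
have ttl k : linear (tt k).
  by move=> q x y; rewrite /tt open_loop_linear t0l !scalerDr !scalerA addrACA mulrC.
exists (fun k => mklinear (ttl k)); split=> [x k|x|] /=.
- by rewrite /tt /= kapS scalerDr opprD addrA mulNr scaleNr scalerA.
- have := ErE (c^* *: X (open_loop x d)); rewrite -/(t0 x) => /eqP.
  rewrite subr_eq => /eqP e.
  rewrite /tt /kap big_ord0 scale1r add0r [in RHS]e scalerDr !scalerA linearD linearZ /=.
  by rewrite !mulrA -normCK c1 expr1n mul1r scale1r.
pose r := 1 - `|c^* * kap d|; have r0 : 0 < r by rewrite subr_gt0.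
have ErM y : `|Er y| <= `|y| / r.
  rewrite ler_pdivlMr // /r mulrBr mulr1.
  apply: le_trans (_ : `|Er y| - `|(c^* * kap d) *: X (Er y)| <= _).
    by rewrite hnormZ Xi mulrC.
  by rewrite -[X in _ <= `|X|](ErE y) lerB_dist.
exists (d%:R + d%:R / r) => [|x B xB k kd].
  by rewrite addr_ge0 ?divr_ge0 ?(ltW r0).
have B0 : 0 <= B.
  have d0 : (0 < d)%N by rewrite lt0n size_eq0.
  by apply: le_trans (xB _ d0).
have ol m : (m <= d)%N -> `|open_loop x m| <= m%:R * B.
  elim: m => [|m IH] md /=; first by rewrite normr0 mul0r.
  apply: le_trans (ler_normB _ _) _; rewrite -natr1 mulrDl mul1r addrC lerD ?xB //.
  rewrite hnormZ norm_conjC; apply: le_trans (IH (ltnW md)).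
  by apply: ler_piMl; rewrite ?normr_ge0 // ltW.
rewrite /tt mulrDl; apply: le_trans (ler_normD _ _) _; rewrite lerD //.
  by apply: le_trans (ol k kd) _; rewrite ler_wpM2r // ler_nat.
rewrite hnormZ; apply: le_trans (ler_piMl (normr_ge0 _) (kap_le1 k)) _.
apply: le_trans (ErM _) _; rewrite mulrAC ler_wpM2r ?invr_ge0 ?(ltW r0) //.
by rewrite hnormZ norm_conjC c1 mul1r Xi ol.
Qed.

(** Each factor is a linear system with input t_k, state x_k, output
   t_(k+1) = x_k - conj a_k t_k and next state a_k x_k + (1 - |a_k|^2) t_k. It
   preserves energy when the state is given the weight w_k = 1/(1 - |a_k|^2). If
   the d systems are connected in series and the loop is closed by X t_d = c t_0,
   the energy is preserved as a whole: the map Y from the states to the next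
   states is an isometry of the weighted space N^d.
   As functions T_k of the state, the signals satisfy T_k = T_(k+1) b_(a_k)(Y).
   Going once round the loop, X T_d = c T_0 = T_d b(Y), hence X T_k = T_k b(Y)
   for every k. The states x_k = T_(k+1) + conj a_k T_k inherit this relation, so
   b(Y) is X on each of the d coordinates. It is unitary, and so is Y. *)
Lemma blaschke_root : exists (K : hilbertType R) (Y B : {linear K -> K}) (J : {linear N -> K}),
  [/\ bijective_isometry Y, isometric J, fcalc Y b B & forall x, B (J x) = J (X x)].
Proof.
have [t [tS tX [M M0 tM]]] := feedback_exists.
pose w k : C := (1 - `|a k| ^+ 2)^-1.
have n1 k : 0 < 1 - `|a k| ^+ 2 by rewrite subr_gt0 exprn_ilt1.
have w1 k : 1 <= w k by rewrite /w invf_ge1 // gerBl exprn_ge0.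
have w0 k : 0 < w k by rewrite invr_gt0.
(* The form only sees the first d terms of a sequence. *)
pose phi (x y : E) : C := \sum_(k < d) w k * hdot (x k) (y k).
have phil q (x y z : E) : phi (q *: x + y) z = q * phi x z + phi y z.
  rewrite /phi mulr_sumr -big_split /=; apply: eq_bigr => k _.
  by rewrite -[(q *: x + y) k]/(q *: x k + y k) hdotDl hdotZl mulrDr mulrCA.
have phic (x y : E) : phi y x = (phi x y)^*.
  rewrite /phi rmorph_sum; apply: eq_bigr => k _.
  by rewrite rmorphM /= -hdotC conj_Creal // ger0_real // ltW.
have phi0 (x : E) : 0 <= phi x x.
  by apply: sumr_ge0 => k _; rewrite mulr_ge0 ?hdot_ge0 // ltW.
have [K [i [iE id]]] := hilbert_completion (Sform phil phic phi0).
have inE (x : E) : `|i x| ^+ 2 = \sum_(k < d) w k * `|x k| ^+ 2.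
  by rewrite -hdot_norm iE /=; apply: eq_bigr => k _; rewrite hdot_norm.
have xk (x : E) k : (k < d)%N -> `|x k| <= `|i x|.
  move=> kd; rewrite -ler_sqr ?nnegrE // inE (bigD1 (Ordinal kd)) //=.
  apply: le_trans (_ : w k * `|x k| ^+ 2 <= _); first by rewrite ler_peMl ?exprn_ge0.
  by rewrite lerDl sumr_ge0 // => j _; rewrite mulr_ge0 ?exprn_ge0 // ltW.
pose Yf (x : E) : E := fun k => a k *: x k + (1 - `|a k| ^+ 2) *: t k x.
have Yl : linear Yf.
  move=> q x y; apply/funext => k.
  rewrite -[RHS]/(q *: Yf x k + Yf y k) /Yf -[(q *: x + y) k]/(q *: x k + y k).
  by rewrite [t k _]linearP /= !scalerDr !scalerA [LHS]addrACA ![q * _]mulrC.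
have telescope (x : E) m : \sum_(k < m) w k * `|Yf x k| ^+ 2 =
    \sum_(k < m) w k * `|x k| ^+ 2 + `|t 0%N x| ^+ 2 - `|t m x| ^+ 2.
  elim: m => [|m IH]; first by rewrite !big_ord0 add0r subrr.
  rewrite !big_ord_recr /= IH tS /Yf.
  suff -> : w m * `|a m *: x m + (1 - `|a m| ^+ 2) *: t m x| ^+ 2 =
      w m * `|x m| ^+ 2 + `|t m x| ^+ 2 - `|x m - (a m)^* *: t m x| ^+ 2 by ring.
  rewrite -!hdot_norm !hdotBl !hdotBr !hdotDl !hdotDr !hdotZl !hdotZr conjCK.
  rewrite rmorphB rmorph1 rmorphXn /= (conj_Creal (normr_real _)) /w.
  have nz : 1 - a m * (a m)^* != 0 by rewrite -normCK gt_eqF.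
  by rewrite normCK; field.
have t0d (x : E) : `|t 0%N x| = `|t d x|.
  by rewrite -(Xi (t d x)) tX hnormZ c1 mul1r.
have Yn (x : E) : `|(i \o mklinear Yl) x| = `|i x|.
  apply/eqP; rewrite -(eqrXn2 (n := 2)) //; apply/eqP.
  by rewrite /= !inE telescope t0d addrK.
have [Y [Yi Yc YI]] := dense_extend id (fun x => eqle (Yn x)).
have {}YI := YI Yn.
have {}Yi (x : E) : Y (i x) = i (Yf x) := Yi x.
have /choice [T hT] : forall k, exists T : {linear K -> N}, (k <= d)%N ->
    bounded T /\ forall x, T (i x) = t k x.
  move=> k; have [kd|] := leqP k d; last first.
    have zl : linear (fun _ : K => 0 : N) by move=> q x y; rewrite scaler0 addr0.
    by exists (mklinear zl).
  have tk x : `|t k x| <= M * `|i x| by apply: tM => // m; exact: xk.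
  by have [T [Tb Ti]] := dense_extend_bounded id M0 tk; exists T.
have Tb k : (k <= d)%N -> bounded (T k) by move=> /hT [].
have Ti k x : (k <= d)%N -> T k (i x) = t k x by move=> /hT [].
have Yb : bounded Y := bounded_nonexpansive Yc.
have TY k z : (k < d)%N ->
    T k z - (a k)^* *: T k (Y z) = T k.+1 (Y z) - a k *: T k.+1 z.
  move=> kd; have kd' := ltnW kd.
  have [Tb1 Tb2] := (Tb _ kd', Tb _ kd).
  have l1 : linear (fun z => T k z - (a k)^* *: T k (Y z)).
    by move=> q x y; rewrite !linearP /= addrACA -scalerDr.
  have l2 : linear (fun z => T k.+1 (Y z) - a k *: T k.+1 z).
    by move=> q x y; rewrite !linearP /= addrACA -scalerDr.
  apply: (@dense_eq_bounded _ _ _ _ i (mklinear l1) (mklinear l2) id) => [||x] /=.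
  - exact: bounded_sub Tb1 (bounded_scale _ (bounded_comp Tb1 Yb)).
  - exact: bounded_sub (bounded_comp Tb2 Yb) (bounded_scale _ Tb2).
  rewrite Yi !Ti // !tS; set y := Yf x.
  have -> : y k = a k *: x k + (1 - `|a k| ^+ 2) *: t k x by [].
  rewrite [a k *: (_ - _)]scalerBr opprB scalerA -normCK scalerBl scale1r.
  by rewrite [RHS]addrC [RHS]addrA [X in _ = X - _]addrA subrK [X in _ = X - _]addrC subrK.
have TB k (Bk : {linear K -> K}) : (k < d)%N -> fcalc Y (bfactor (a k)) Bk ->
    forall z, T k z = T k.+1 (Bk z).
  move=> kd hBk z; have [Er ErE] := resolvent (a := (a k)^*) Yc ltac:(by rewrite norm_conjC).
  rewrite -(ErE z) (fcalc_bfactor Yc (a1 k) hBk); move: (Er z) => y.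
  by rewrite [LHS]linearB [RHS]linearB [X in _ - X = _]linearZ [X in _ = _ - X]linearZ; exact: TY.
have comm f (F G : {linear K -> K}) g : approximable f -> approximable g ->
    fcalc Y f F -> fcalc Y g G -> forall z, F (G z) = G (F z).
  move=> fa ga hF hG; have [MF MF0 fMF] := approximable_bounded fa.
  apply: (fcalc_intertwine_bounded ga hG hG).
    by exists MF => //; exact: fcalc_bound Yc fa hF fMF.
  move=> z; symmetry; apply: (fcalc_intertwine_bounded fa hF hF Yb) => //.
have chain u : forall m (P : {linear K -> K}), (m + size u)%N = d -> drop m s = u ->
    fcalc Y (blaschke c u) P -> forall z, c *: T m z = T d (P z).
  elim: u => [|e u IH] m P.
    rewrite addn0 => -> _ hP z.
    by rewrite (fcalc_blaschke_nil Yc hP) linearZ.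
  move=> md dm hP z; have md' : (m < d)%N by rewrite -md addnS ltnS leq_addr.
  have eu1 : zeros_in_disk (e :: u) by move=> x; rewrite -dm => /mem_drop /s1.
  have em : e = a m by move: dm; rewrite (drop_nth 0 md') => -[<-].
  have um : drop m.+1 s = u by move: dm; rewrite (drop_nth 0 md') => -[_].
  have [e1 u1] := zeros_in_disk_cons eu1.
  have [Ba [Bs [hBa hBs PE]]] := fcalc_blaschke_cons Yc eu1 hP.
  rewrite PE (comm _ _ _ _ (approximable_bfactor e1) (approximable_blaschke c u1) hBa hBs).
  have mu : (m.+1 + size u)%N = d by rewrite -md addnS.
  by rewrite -(IH m.+1 Bs mu um hBs); congr (_ *: _); apply: TB => //; rewrite -em.
have [B hB] := fcalc_exists Yc ab.
have XTd z : X (T d z) = T d (B z).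
  rewrite -(chain s 0%N B) ?drop0 //; have d0 : (0 <= d)%N by [].
  have l2 : linear (fun z => c *: T 0%N z).
    by move=> q x y; rewrite !linearP.
  apply: (@dense_eq_bounded _ _ _ _ i (X \o T d) (mklinear l2) id) => [||x] /=.
  - exact: bounded_comp (bounded_nonexpansive (isometric_nonexpansive Xi)) (Tb _ (leqnn _)).
  - exact: bounded_scale (Tb _ d0).
  by rewrite !Ti.
have XT j : forall k z, (k + j)%N = d -> X (T k z) = T k (B z).
  elim: j => [|j IH] k z; first by rewrite addn0 => ->.
  move=> kj; have kd : (k < d)%N by rewrite -kj addnS ltnS leq_addr.
  have [Bk hBk] := fcalc_exists Yc (approximable_bfactor (a1 k)).
  rewrite !(TB k Bk) // IH; last by rewrite -kj addnS.
  by rewrite (comm _ _ _ _ ab (approximable_bfactor (a1 k)) hB hBk).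
pose P k : {linear K -> N} := T k.+1 \+ ((a k)^* \*: T k).
have PE k z : P k z = T k.+1 z + (a k)^* *: T k z by [].
have Pi k x : (k < d)%N -> P k (i x) = x k.
  by move=> kd; rewrite PE !Ti ?tS ?subrK // ltnW.
have Pb k : (k < d)%N -> bounded (P k).
  move=> kd; exact: bounded_add (Tb _ kd) (bounded_scale _ (Tb _ (ltnW kd))).
have XP k z : (k < d)%N -> X (P k z) = P k (B z).
  move=> kd; rewrite !PE linearD linearZ /= (XT (d - k.+1)%N k.+1) ?subnKC //.
  by rewrite (XT (d - k)%N k) // subnKC // ltnW.
have dl k : linear (fun h : N => (fun m => if m == k then h else 0) : E).
  move=> q x y; apply/funext => m.
  rewrite -[RHS]/(q *: (if m == k then x else 0) + (if m == k then y else 0)).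
  by case: ifP; rewrite // scaler0 addr0.
pose J k : {linear N -> K} := i \o mklinear (dl k).
have JE k h : J k h = i (fun m => if m == k then h else 0) by [].
have Jn k h : (k < d)%N -> `|J k h| ^+ 2 = w k * `|h| ^+ 2.
  move=> kd; rewrite JE inE (bigD1 (Ordinal kd)) //= eqxx big1 ?addr0 // => m mk.
  by rewrite -[m == k :> nat]/(m == Ordinal kd) (negPf mk) normr0 expr0n mulr0.
have Jb k : (k < d)%N -> bounded (J k).
  move=> kd; exists (sqrtC (w k)) => [|x]; first by rewrite sqrtC_ge0 ltW.
  rewrite -ler_sqr ?nnegrE ?mulr_ge0 ?sqrtC_ge0 ?(ltW (w0 k)) //.
  by rewrite Jn // exprMn sqrtCK.
have recon z : z = \sum_(k < d) J k (P k z).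
  have l2 : linear (fun z => \sum_(k < d) J k (P k z)).
    move=> q x y; rewrite scaler_sumr -big_split /=; apply: eq_bigr => k _.
    exact: etrans (congr1 (J k) (linearP (P k) q x y)) (linearP (J k) q (P k x) (P k y)).
  apply: (@dense_eq_bounded _ _ _ _ i idfun (mklinear l2) id) => [||x] /=.
  - exact: bounded_nonexpansive.
  - exact: (@bounded_sum R K K d (fun k z => J k (P k z)) (fun k kd => bounded_comp (Jb k kd) (Pb k kd))).
  transitivity (\sum_(k < d) J k (x k)); last first.
    by apply: eq_bigr => k _; rewrite -[RHS]/(J k (P k (i x))) Pi.
  have vs m n : (\sum_(k < m) mklinear (dl k) (x k) : E) n = if (n < m)%N then x n else 0.
    elim: m => [|m IH]; first by rewrite big_ord0.
    rewrite big_ord_recr -[LHS]/((\sum_(k < m) mklinear (dl k) (x k) : E) n + (if n == m then x m else 0)) IH.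
    rewrite [in RHS]ltnS [in RHS]leq_eqVlt; case: eqP => [->|_]; first by rewrite ltnn /= add0r.
    by rewrite /= addr0.
  apply/eqP; rewrite -subr_eq0 -linear_sum -linearB -normr_eq0 -sqrf_eq0 inE big1 // => k _.
  rewrite -[(x - _) k]/(x k - (\sum_(k < d) mklinear (dl k) (x k) : E) k) vs ltn_ord subrr.
  by rewrite normr0 expr0n mulr0.
have BJ k h : (k < d)%N -> B (J k h) = J k (X h).
  move=> kd; rewrite (recon (B (J k h))).
  transitivity (\sum_(m < d) (if m == k :> nat then J k (X h) else 0)).
    apply: eq_bigr => m _; rewrite -(XP m _ (ltn_ord m)).
    have -> : P m (J k h) = (if m == k :> nat then h else 0) := Pi m _ (ltn_ord m).
    case: eqP => [->|_] //; exact: etrans (congr1 (J m) (linear0 X)) (linear0 (J m)).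
  rewrite (bigD1 (Ordinal kd)) //= eqxx big1 ?addr0 // => m mk.
  by rewrite -[m == k :> nat]/(m == Ordinal kd) (negPf mk).
have [X' [_ X'K _]] := bijective_isometry_inv Xu.
have Bi : isometric B := blaschke_isometric c1 s1 YI hB.
have Bu : bijective_isometry B.
  apply: (onto_isometry_bijective Bi) => y; exists (\sum_(k < d) J k (X' (P k y))).
  rewrite linear_sum [RHS]recon; apply: eq_bigr => k _.
  by rewrite BJ // X'K.
have d0 : (0 < d)%N by rewrite lt0n size_eq0.
pose r := (sqrtC (w 0%N))^-1.
have rl : linear (fun x => r *: J 0%N x).
  by move=> q x y; rewrite (linearP (J 0%N)) scalerDr !scalerA mulrC.
exists K, Y, B, (mklinear rl); split; [| |exact: hB|].
- exact: bijective_of_blaschke s1 s0 YI hB Bu.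
- move=> x; rewrite mklinearE; apply/eqP; rewrite -(eqrXn2 (n := 2)) //; apply/eqP.
  rewrite hnormZ exprMn Jn // ger0_norm.
    by rewrite exprVn sqrtCK mulrA mulVf ?mul1r ?gt_eqF.
  by rewrite invr_ge0 sqrtC_ge0 ltW.
- move=> x; exact: etrans (linearZ_LR B r (J 0%N x)) (congr1 (fun y => r *: y) (BJ 0%N x d0)).
Qed.

End BlaschkeRoot.

(** * Making the intertwiner coisometric *)

Section Coisometry.
Context {R : realType}.
Local Notation C := R[i].
Implicit Types (H K L : hilbertType R).
Variables (c : C) (s : seq C).
Hypotheses (c1 : `|c| = 1) (s1 : zeros_in_disk s) (s0 : s != [::]).
Local Notation b := (blaschke c s).

Let ab : approximable b := approximable_blaschke c s1.

Lemma adjoint_intertwine K (U S D S' : {linear K -> K}) : bijective_isometry U -> bijective_isometry D ->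
  (forall x, U (S x) = S (D x)) -> (forall x y, hdot (S x) y = hdot x (S' y)) ->
  forall x, S' (U x) = D (S' x).
Proof.
move=> Uu Du US SS' x; have [D' [_ D'K _]] := bijective_isometry_inv Du.
apply/eqP; rewrite -subr_eq0; apply/eqP/hdot_eq0 => y.
rewrite hdotC hdotBr -SS' -[y]D'K -US !isometric_hdot ?SS' ?subrr ?conjC0 //.
- exact: Du.1.
- exact: Uu.1.
Qed.

(** The norm of Def x is determined by those of x and S' x. The map U preserves
   the first, and the second because S' U = D S'. *)
Lemma defect_unitary K L (U D S' : {linear K -> K}) (Def : {linear K -> L}) :
  bijective_isometry U -> bijective_isometry D -> (forall x, S' (U x) = D (S' x)) -> dense_map Def ->
  (forall x, `|S' x| ^+ 2 + `|Def x| ^+ 2 = `|x| ^+ 2) ->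
  exists X : {linear L -> L}, bijective_isometry X /\ forall x, X (Def x) = Def (U x).
Proof.
move=> Uu Du SU dd SD; have [V [UV VU Vu]] := bijective_isometry_inv Uu.
have DU x : `|Def (U x)| = `|Def x|.
  apply/eqP; rewrite -(eqrXn2 (n := 2)) //; apply/eqP.
  by apply: (addrI (`|S' x| ^+ 2)); rewrite SD -[in LHS](Du.1 (S' x)) -SU SD Uu.1.
have DV x : `|Def (V x)| = `|Def x| by rewrite -DU VU.
have [X [XE Xc XI]] := @dense_extend R K L L Def (Def \o U) dd (fun x => eqle (DU x)).
have [Y [YE Yc _]] := @dense_extend R K L L Def (Def \o V) dd (fun x => eqle (DV x)).
exists X; split=> //; apply: (onto_isometry_bijective (XI DU)) => y; exists (Y y).
apply: (dense_eq_bounded (f := X \o Y) (g := idfun) dd) => [||x] /=.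
- exact/bounded_nonexpansive/nonexpansive_comp.
- exact: bounded_nonexpansive.
- by rewrite YE /= XE /= VU.
Qed.

Lemma diagonal_isometric (F : nat -> hilbertType R) K (i : forall n, {linear F n -> K})
    (A : forall n, {linear F n -> F n}) : is_hilbert_sum i -> (forall n, isometric (A n)) ->
  exists U : {linear K -> K}, isometric U /\ forall n x, U (i n x) = i n (A n x).
Proof.
move=> [iI io iE iU] Ai.
have fI n : isometric (i n \o A n) := isometric_comp (iI n) (Ai n).
have [m n x y mn|U [UE _ UI]] := iE K (fun n => i n \o A n) (fun n => isometric_nonexpansive (fI n)).
  exact: io.
by exists U; split; [exact: UI | exact: UE].
Qed.

Lemma diagonal_bijective (F : nat -> hilbertType R) K (i : forall n, {linear F n -> K})
    (A : forall n, {linear F n -> F n}) : is_hilbert_sum i -> (forall n, bijective_isometry (A n)) ->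
  exists U : {linear K -> K}, bijective_isometry U /\ forall n x, U (i n x) = i n (A n x).
Proof.
move=> iS Au; have [U [UI UE]] := diagonal_isometric iS (fun n => (Au n).1).
have invA n : {V : {linear F n -> F n} | [/\ cancel (A n) V, cancel V (A n) & bijective_isometry V]}.
  exact/cid/bijective_isometry_inv.
have invI n : isometric (sval (invA n)) by case: (svalP (invA n)) => _ _ [].
have [V [VI VE]] := diagonal_isometric iS invI.
exists U; split=> //; apply: (onto_isometry_bijective UI) => y; exists (V y).
have [iI io iE iU] := iS; apply: (iU K (U \o V) idfun) => // [|n x].
  by apply: nonexpansive_comp; exact: isometric_nonexpansive.
by rewrite /= VE UE; case: (svalP (invA n)) => _ ->.
Qed.

(** A unitary is bundled with its space so that taking roots can be iterated. *)
Record unitary_pair := UnitaryPair {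
  up_space : hilbertType R ;
  up_op : {linear up_space -> up_space} ;
  up_bijective : bijective_isometry up_op
}.

Definition root_of (u v : unitary_pair) (J : {linear up_space u -> up_space v}) :=
  isometric J /\ forall B, fcalc (up_op v) b B ->
    forall x, B (J x) = J (up_op u x).

Lemma root_tower (u : unitary_pair) : exists (v : nat -> unitary_pair)
    (J : forall n, {linear up_space (v n) -> up_space (v n.+1)}),
  v 0%N = u /\ forall n, root_of (J n).
Proof.
have /choice [next hnext] : forall w : unitary_pair, exists w' : unitary_pair,
    exists J : {linear up_space w -> up_space w'}, root_of J.
  move=> [N X Xu]; have [K [Y [B [J [Yu Ji hB BJ]]]]] := blaschke_root c1 s1 s0 Xu.
  exists (UnitaryPair Yu), J; split=> //= B' hB' x.
  by rewrite -(fcalc_unique ab hB hB') BJ.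
pose v n := iter n next u.
exists v, (fun n => sval (cid (hnext (v n)))); split=> // n.
exact: (svalP (cid (hnext (v n)))).
Qed.

(** J is the isometric coextension of the adjoint of S, except that the copies of
   the defect space grow: b(U) J = J U says that the unitary on the (n+1)-st copy
   is, on the image of the n-th one, a b-root of the previous unitary, and such a
   root need not exist without enlarging the space. On the first copy the
   relation comes from S^* U = b(U) S^*, the adjoint of U S = S b(U). *)
Lemma coisometric_extension K (U S D : {linear K -> K}) :
  bijective_isometry U -> nonexpansive S -> fcalc U b D -> (forall x, U (S x) = S (D x)) ->
  exists (K' : hilbertType R) (e : {linear K -> K'}) (U' J B : {linear K' -> K'}),
    [/\ isometric e, bijective_isometry U', isometric J, fcalc U' b B &
     [/\ forall x, B (J x) = J (U' x), forall x, U' (e x) = e (U x) &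
         forall m x y, hdot (e x) (iter m J (e y)) = hdot (iter m S x) y]].
Proof.
move=> Uu Sc hD US; have Ui := Uu.1.
have Du : bijective_isometry D := blaschke_bijective c1 s1 Uu hD.
have [S' [S'c SS']] := adjoint_exists Sc.
have SU := adjoint_intertwine Uu Du US SS'.
have [L [Def [SD dd]]] := defect_space S'c.
have [X0 [X0u X0E]] := defect_unitary Uu Du SU dd SD.
have [v [J [v0 vJ]]] := root_tower (UnitaryPair X0u).
have [Def' [X0E' SD']] : exists Def' : {linear K -> up_space (v 0%N)},
    (forall x, up_op (v 0%N) (Def' x) = Def' (U x)) /\
    (forall x, `|S' x| ^+ 2 + `|Def' x| ^+ 2 = `|x| ^+ 2).
  by rewrite v0; exists Def.
pose F n : hilbertType R := if n is k.+1 then up_space (v k.+1) else K.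
pose A n : {linear F n -> F n} :=
  match n return {linear F n -> F n} with 0 => U | k.+1 => up_op (v k.+1) end.
have Au n : bijective_isometry (A n) by case: n => [|k] //; exact: up_bijective (v k.+1).
have [K' [i iS]] := hilbert_sum F; have [iI io iE iU] := iS.
have [U' [U'u U'E]] := diagonal_bijective iS Au.
have o01 (x : K) (y : up_space (v 1%N)) : hdot (i 0%N x) (i 1%N y) = 0.
  exact: (io 0%N 1%N x y isT).
have jl : linear (fun x : K => i 0%N (S' x) + i 1%N (J 0%N (Def' x))).
  by move=> q x y; rewrite !linearP /= addrACA -scalerDr.
pose fJ n : {linear F n -> K'} :=
  match n return {linear F n -> K'} with 0 => mklinear jl | k.+1 => i k.+2 \o J k.+1 end.
have fJI n : isometric (fJ n).
  case: n => [|k] x; last by rewrite /= (iI k.+2); exact: (vJ k.+1).1.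
  apply/eqP; rewrite -(eqrXn2 (n := 2)) //; apply/eqP.
  by rewrite /= hnormD_orth ?o01 // (iI 0%N) (iI 1%N) (vJ 0%N).1 SD'.
have [m n x y mn|W [WE _ WI]] := iE K' fJ (fun n => isometric_nonexpansive (fJI n)).
  case: m x mn => [|m] x; case: n y => [|n] y //= mn; last exact: (io m.+2 n.+2 _ _ mn).
    by rewrite hdotDl (io 0%N n.+2 _ _ isT) (io 1%N n.+2 _ _ isT) addr0.
  by rewrite hdotDr (io m.+2 0%N _ _ isT) (io m.+2 1%N _ _ isT) addr0.
have {}WI := WI fJI.
have W0 (x : K) : W (i 0%N x) = i 0%N (S' x) + i 1%N (J 0%N (Def' x)) := WE 0%N x.
have Wn k (x : up_space (v k.+1)) : W (i k.+1 x) = i k.+2 (J k.+1 x) := WE k.+1 x.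
have U'c := isometric_nonexpansive U'u.1.
have [B hB] := fcalc_exists U'c ab.
have Bi : isometric B := blaschke_isometric c1 s1 U'u.1 hB.
have BE n (Bn : {linear F n -> F n}) x : fcalc (A n) b Bn -> B (i n x) = i n (Bn x).
  move=> hBn; symmetry; apply: (fcalc_intertwine_bounded ab hBn hB).
    exact/bounded_nonexpansive/isometric_nonexpansive.
  by move=> y; rewrite U'E.
have [p [pE pc]] : exists p : {linear K' -> K}, (forall x, p (i 0%N x) = x) /\ nonexpansive p.
  exact: (@douglas R K K' K (i 0%N) idfun (fun x => eqle (esym (iI 0%N x)))).
have pA := left_inverse_adjoint (iI 0%N) pc pE.
have p1 n (x : F n.+1) : p (i n.+1 x) = 0.
  by apply: hdot_eq0 => y; rewrite pA; exact: (io n.+1 0%N x y isT).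
have pW z : p (W z) = S' (p z).
  apply: (iU K (p \o W) (S' \o p)); try exact: nonexpansive_comp.
  - exact: nonexpansive_comp pc (isometric_nonexpansive WI).
  - case=> [|n] x /=; first by rewrite W0 linearD /= !pE p1 addr0.
    by rewrite Wn !p1 linear0.
exists K', (i 0%N), U', W, B; split=> //; first exact: (iI 0%N).
split=> [z|x|m x y].
- apply: (iU K' (B \o W) (W \o U')).
  + exact: nonexpansive_comp (isometric_nonexpansive Bi) (isometric_nonexpansive WI).
  + exact: nonexpansive_comp (isometric_nonexpansive WI) U'c.
  case=> [|n] x /=.
    have [B1 hB1] := fcalc_exists (isometric_nonexpansive (Au 1%N).1) ab.
    rewrite U'E !W0 linearD /= (BE 0%N D) // (BE 1%N B1) //.
    by rewrite ((vJ 0%N).2 B1 hB1) X0E' SU.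
  have [B1 hB1] := fcalc_exists (isometric_nonexpansive (Au n.+2).1) ab.
  by rewrite U'E !Wn (BE n.+2 B1) // ((vJ n.+1).2 B1 hB1).
- exact: (U'E 0%N).
have -> : hdot (i 0%N x) (iter m W (i 0%N y)) = hdot x (iter m S' y).
  rewrite hdotC -pA -hdotC; congr (hdot x _).
  by elim: m => [|m IH] /=; rewrite ?pE // pW IH.
by elim: m y => [|m IH] y //=; rewrite SS' -IH -iterSr.
Qed.

End Coisometry.

(** * Making the intertwiner unitary *)

Section UnitaryPair.
Context {R : realType}.
Local Notation C := R[i].
Implicit Types (H K L : hilbertType R).
Variables (c : C) (s : seq C).
Hypotheses (c1 : `|c| = 1) (s1 : zeros_in_disk s).
Local Notation b := (blaschke c s).

Let ab : approximable b := approximable_blaschke c s1.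

(** On the n-th level of the direct limit along J the unitary acts as the n-th
   iterate of b applied to U, which b(U) J = J U makes compatible with J, and W
   moves one level up. Then U W = W b(U) holds because U is one iterate further
   on the level that W enters. *)
Lemma unitary_direct_limit K (U J B : {linear K -> K}) :
  bijective_isometry U -> isometric J -> fcalc U b B -> (forall x, B (J x) = J (U x)) ->
  exists (K' : hilbertType R) (e : {linear K -> K'}) (U' W W' B' : {linear K' -> K'}),
    [/\ isometric e, bijective_isometry U', bijective_isometry W /\ (cancel W W' /\ cancel W' W), fcalc U' b B' &
     [/\ forall x, U' (W x) = W (B' x), forall x, U' (e x) = e (U x) &
         forall x, W' (e x) = e (J x)]].
Proof.
move=> Uu Ji hB BJ.
have /choice [next hnext] : forall V : {linear K -> K}, exists F : {linear K -> K},
    bijective_isometry V -> fcalc V b F.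
  move=> V; have [/isometric_nonexpansive Vc|Vi] := pselect (isometric V).
    by have [F hF] := fcalc_exists Vc ab; exists F.
  by exists V => -[].
pose V n := iter n next U.
have Vu n : bijective_isometry (V n).
  elim: n => [|n IH]; first exact: Uu.
  exact: (blaschke_bijective c1 s1 IH (hnext _ IH)).
have hV n : fcalc (V n) b (V n.+1) := hnext _ (Vu n).
have Jb : bounded J := bounded_nonexpansive (isometric_nonexpansive Ji).
have VJ n x : V n.+1 (J x) = J (V n x).
  elim: n x => [|n IH] x.
    by rewrite (fcalc_unique ab (hV 0%N) hB) BJ.
  by symmetry; apply: (fcalc_intertwine_bounded ab (hV n) (hV n.+1) Jb).
have [K' [e [eI eJ eE eU]]] := direct_limit Ji.
have ec n : nonexpansive (e n) := isometric_nonexpansive (eI n).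
have [|n x|U' [U'E _ U'I]] := eE K' (fun n => e n \o V n).
- by move=> n; exact: nonexpansive_comp (ec n) (isometric_nonexpansive (Vu n).1).
- by rewrite /= VJ eJ.
have {}U'I : isometric U' by apply: U'I => n; exact: isometric_comp (eI n) (Vu n).1.
have {}U'E n x : U' (e n x) = e n (V n x) := U'E n x.
have U'c := isometric_nonexpansive U'I.
have /choice [Vi hVi] : forall n, exists F : {linear K -> K},
    [/\ cancel (V n) F, cancel F (V n) & bijective_isometry F] by move=> n; exact: bijective_isometry_inv.
have [|n x|Y [YE Yc _]] := eE K' (fun n => e n \o Vi n).
- by move=> n; have [_ _ u] := hVi n; exact: nonexpansive_comp (ec n) (isometric_nonexpansive u.1).
- have [_ VVi _] := hVi n; have [ViV _ _] := hVi n.+1.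
  by rewrite /= -{1}[x]VVi -VJ ViV eJ.
have U'u : bijective_isometry U'.
  apply: (onto_isometry_bijective U'I) => y; exists (Y y).
  apply: (eU K' (U' \o Y) idfun) => //; first exact: nonexpansive_comp.
  move=> n x; have [_ VVi _] := hVi n.
  by rewrite /= YE /= U'E VVi.
have [|n x|W [WE Wc WI]] := eE K' (fun n => e n.+1); [by move=> n; exact: ec|by rewrite eJ|].
have {}WI : isometric W by exact: WI.
have [|n x|W' [W'E W'c _]] := eE K' (fun n => e n \o J).
- by move=> n; exact: nonexpansive_comp (ec n) (isometric_nonexpansive Ji).
- by rewrite /= eJ.
have {}W'E n x : W' (e n x) = e n (J x) := W'E n x.
have WW' x : W (W' x) = x.
  apply: (eU K' (W \o W') idfun) => //; first exact: nonexpansive_comp.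
  by move=> n y; rewrite /= W'E WE eJ.
have Wu : bijective_isometry W by apply: (onto_isometry_bijective WI) => y; exists (W' y).
have W'W x : W' (W x) = x by apply: (isometric_inj WI); rewrite WW'.
have [B' hB'] := fcalc_exists U'c ab.
have B'E n x : B' (e n x) = e n (V n.+1 x).
  symmetry; apply: (fcalc_intertwine_bounded ab (hV n) hB'); first exact/bounded_nonexpansive.
  by move=> y; rewrite U'E.
exists K', (e 0%N), U', W, W', B'; split=> //; split=> [x|x|x].
- have B'c := isometric_nonexpansive (blaschke_isometric c1 s1 U'I hB').
  apply: (eU K' (U' \o W) (W \o B')).
  + exact: nonexpansive_comp U'c Wc.
  + exact: nonexpansive_comp Wc B'c.
  by move=> n y; rewrite /= B'E !WE U'E.
- exact: U'E.
- exact: W'E.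
Qed.

End UnitaryPair.

(** * The dilation theorem *)

Lemma blaschkeE (R : realType) (c : R[i]) (s : seq R[i]) z :
  blaschke c s z = c * \prod_(a <- s) ((z - a) / (1 - Num.conj a * z)).
Proof.
elim: s => [|a s IH] /=; first by rewrite big_nil mulr1.
by rewrite big_cons IH mulrCA.
Qed.

Lemma orth_proj_range (R : realType) (H K : hilbertType R) (J : {linear H -> K}) x h :
  isometric_embedding J -> (forall h', hdot x (J h') = hdot h h') ->
  orth_proj (range J) x = J h.
Proof.
move=> Ji xh; apply: get_unique.
  by split=> [|_ [h' _ <-]]; [exists h | rewrite hdotBl Ji xh subrr].
move=> _ [[h1 _ <-] o]; congr (J _); apply/eqP; rewrite -subr_eq0; apply/eqP/hdot_eq0 => h'.
have /eqP := o (J h') ltac:(by exists h').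
by rewrite hdotBl Ji xh subr_eq0 hdotBl => /eqP ->; rewrite subrr.
Qed.

Theorem corollary2p5 (R : realType) (b : R[i] -> R[i])
    (alpha : disk_algebra R -> disk_algebra R)
    (H : hilbertType R) (A T : {linear H -> H}) :
  finite_blaschke b -> nonconstant_on_disk b -> induced_by b alpha ->
  contractive A -> contractive T ->
  A \o T = T \o endo_op alpha A ->
  exists (K : hilbertType R) (J : {linear H -> K}) (U W : {linear K -> K}),
    [/\ isometric_embedding J, unitary U, unitary W,
        forall (m n : nat) (x : H),
          orth_proj (range J) (iter m W (iter n U (J x)))
            = J (iter m T (iter n A x))
      & U \o W = W \o endo_op alpha U].
Proof.
move=> [c [s [c1 s1 bE]]] [z [w [zd wd bzw]]] ab Ac Tc AT.
have s0 : s != [::].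
  by apply/eqP => s0; apply: bzw; rewrite !bE // s0 !big_nil.
have bs := approximable_blaschke c s1.
have bz y : closed_disk y -> blaschke c s y = alpha disk_z y.
  by move=> yd; rewrite ab //= bE // blaschkeE.
have fa := approximable_ext bz bs.
have endoE (K : hilbertType R) (V F : {linear K -> K}) : fcalc V (blaschke c s) F -> endo_op alpha V = F.
  by move=> hF; apply: disk_calculusE fa _; exact: fcalc_ext bz hF.
have [B hB] := fcalc_exists Ac bs.
have {}AT x : A (T x) = T (B x).
  by move/(congr1 (fun f => f x)) : AT; rewrite /= (endoE _ _ _ hB).
have [K1 [j [p [V [S [D [[ji pc] Vi Sc hD [pj pV pS VS]]]]]]]] :=
  intertwining_lift c1 s1 Ac Tc hB AT.
have [K2 [e [U2 [S2 [D2 [ei U2u S2c hD2 [US2 U2e S2e]]]]]]] :=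
  unitary_extension c1 s1 s0 Vi Sc hD VS.
have [K3 [i [U3 [J3 [B3 [ii U3u J3i hB3 [BJ3 U3i J3S]]]]]]] :=
  coisometric_extension c1 s1 s0 U2u S2c hD2 US2.
have [K [f [U [W [W' [F [fi Uu [Wu [W'W WW']] hF [UW Uf W'f]]]]]]]] :=
  unitary_direct_limit c1 s1 U3u J3i hB3 BJ3.
pose emb : {linear H -> K} := f \o i \o e \o j.
have embI : isometric emb by move=> x; rewrite /= fi ii ei ji.
have embE : isometric_embedding emb by exact: isometric_hdot.
exists K, emb, U, W; split=> //.
- exact: bijective_isometry_unitary.
- exact: bijective_isometry_unitary.
- move=> m n x; apply: (orth_proj_range embE) => h.
  have Un k y : iter k U (f (i (e y))) = f (i (e (iter k V y))).
    by elim: k => [|k IH] //=; rewrite IH Uf U3i U2e.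
  have Wm k u v : hdot (iter k W u) v = hdot u (iter k W' v).
    elim: k v => [|k IH] v //.
    by rewrite /= -[v in LHS]WW' (isometric_hdot Wu.1) IH -iterSr.
  have W'n k y : iter k W' (f y) = f (iter k J3 y).
    by elim: k => [|k IH] //=; rewrite IH W'f.
  have S2n k y : iter k S2 (e y) = e (iter k S y).
    by elim: k => [|k IH] //=; rewrite IH S2e.
  have pSn k y : p (iter k S y) = iter k T (p y).
    by elim: k => [|k IH] //=; rewrite pS IH.
  have pVn k y : p (iter k V y) = iter k A (p y).
    by elim: k => [|k IH] //=; rewrite pV IH.
  rewrite /= Un Wm W'n (isometric_hdot fi) J3S S2n (isometric_hdot ei).
  by rewrite -(left_inverse_adjoint ji pc pj) pSn pVn pj.
- by rewrite (endoE _ _ _ hF); apply/funext => x; exact: UW.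
Qed.
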